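(* Let $v\in\{1,\dots,d\}$, let $N^v_{2,CVM}=\int_{\mathbb{R}^k}\mathbb{E}\left[(F(t)-F^v(t))^2\right]dF(t)$, and let $\widehat N^v_{2,CVM}$ be its Pick and Freeze estimator defined in the context. Then, as $N\to\infty$, $\sqrt N\left(\widehat N^v_{2,CVM}-N^v_{2,CVM}\right)$ converges in distribution to the centered Gaussian law with variance $$\xi^2=\mathrm{Var}(U)+\mathrm{Var}(V),$$ where $$U=\widetilde G(W)-F(W)^2,\qquad V=\int_{\mathbb{R}^k}\left[\mathbf 1_{\{Z^{v,1}\le t\}}\mathbf 1_{\{Z^{v,2}\le t\}}-\left(\mathbf 1_{\{Z^{v,1}\le t\}}+\mathbf 1_{\{Z^{v,2}\le t\}}\right)F(t)\right]dF(t),$$ and $\widetilde G(t)=\mathbb{P}\left(Z^{v,1}\le t,\ Z^{v,2}\le t\right)$.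
   Context: Let $X=(X_1,\dots,X_d)$ be a vector of independent random inputs with values in $E_1\times\dots\times E_d$ and let $Z=f(X_1,\dots,X_d)\in\mathbb{R}^k$ with $f$ measurable. For $s,t\in\mathbb{R}^k$, $s\le t$ means $s_i\le t_i$ for all $i=1,\dots,k$. Let $F(t)=\mathbb{P}(Z\le t)$ be the distribution function of $Z$ and $F^v(t)=\mathbb{P}(Z\le t\mid X_v)$ the conditional distribution function given $X_v$ (a random variable for each $t$). Integration $dF(t)$ is integration with respect to the law of $Z$. Pick and Freeze pair: $Z^{v,1}=Z=f(X)$ and $Z^{v,2}=f(X^v)$, where $X^v_v=X_v$ and, for $i\neq v$, $X^v_i=X'_i$ with $X'_i$ an independent copy of $X_i$ (all copies independent of each other and of $X$). $W$ denotes a copy of $Z$ independent of $(Z^{v,1},Z^{v,2})$. Design: $(Z^{v,1}_j,Z^{v,2}_j)$, $j=1,2,\dots$, are i.i.d. copies of $(Z^{v,1},Z^{v,2})$, and $W_k$, $k=1,2,\dots$, are i.i.d. copies of $Z$, independent of the sequence $(Z^{v,1}_j,Z^{v,2}_j)_j$. The estimator is $$\widehat N^{v}_{2,CVM}=\frac1N\sum_{k=1}^N\left\{\frac1N\sum_{j=1}^N\mathbf 1_{\{Z^{v,1}_j\le W_k\}}\mathbf 1_{\{Z^{v,2}_j\le W_k\}}-\left[\frac1{2N}\sum_{j=1}^N\left(\mathbf 1_{\{Z^{v,1}_j\le W_k\}}+\mathbf 1_{\{Z^{v,2}_j\le W_k\}}\right)\right]^2\right\}.$$ *)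

(* Defs.v *)
From HB Require Import structures.
From mathcomp Require Import all_boot all_order all_algebra finmap.
From mathcomp Require Import all_classical all_reals all_analysis.

Set Implicit Arguments.
Unset Strict Implicit.
Unset Printing Implicit Defensive.

Import Order.TTheory GRing.Theory Num.Theory.
Import numFieldNormedType.Exports.

Local Open Scope classical_set_scope.
Local Open Scope ring_scope.

Section product_space.
Context (d : nat) (dE : 'I_d -> measure_display)
  (E : forall i : 'I_d, measurableType (dE i)).

Definition cylinders : set_system (forall i, E i) :=
  \bigcup_(i in [set: 'I_d])
    preimage_set_system setT (fun x : forall i, E i => x i) measurable.

(* E_1 x ... x E_d with its product sigma-algebra *)
Definition prod_space := g_sigma_algebraType cylinders.

End product_space.

Arguments cylinders {d dE} E.

Section model.
Context (d : nat) (dE : 'I_d -> measure_display)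
  (E : forall i : 'I_d, measurableType (dE i)).
Context (dO : measure_display) (Omega : measurableType dO) (R : realType)
  (P : probability Omega R).

Definition joint (X : forall i, {RV P >-> E i}) (w : Omega) : prod_space E :=
  fun i => X i w.

Lemma measurable_joint (X : forall i, {RV P >-> E i}) :
  measurable_fun setT (joint X).
Proof.
refine (@measurability _ _ Omega (prod_space E) setT (joint X) (cylinders E) erefl _).
move=> _ [_ [i _ [B mB <-]] <-]; rewrite setTI setTI.
have -> : joint X @^-1` ((fun x : forall i, E i => x i) @^-1` B) = X i @^-1` B by [].
by rewrite -[X in measurable X]setTI; exact: measurable_funP.
Qed.

HB.instance Definition _ (X : forall i, {RV P >-> E i}) :=
  isMeasurableFun.Build _ _ _ _ (joint X) (measurable_joint X).

Definition output (d' : measure_display) (T' : measurableType d')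
    (f : {mfun prod_space E >-> T'}) (X : forall i, {RV P >-> E i}) :
  {RV P >-> T'} := f \o joint X.

Definition freeze (v : 'I_d) (X X' : forall i, {RV P >-> E i}) (i : 'I_d) :
  {RV P >-> E i} := if i == v then X i else X' i.

End model.

Section laws_and_independence.
Context (dO : measure_display) (Omega : measurableType dO) (R : realType)
  (P : probability Omega R).

Definition same_law (d' : measure_display) (T' : measurableType d')
    (X Y : Omega -> T') :=
  forall B, measurable B -> P (X @^-1` B) = P (Y @^-1` B).

Definition independent2 (G H : set_system Omega) :=
  forall A B, G A -> H B -> P (A `&` B) = (P A * P B)%E.

(* mutual independence of the set systems F i, for i in D *)
Definition independent (I : choiceType) (D : set I)
    (F : I -> set_system Omega) :=
  forall (J : {fset I}) (A : I -> set Omega),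
    [set` J] `<=` D -> (forall i, i \in J -> F i (A i)) ->
    P (\bigcap_(i in [set` J]) A i) = (\prod_(i <- J) fine (P (A i)))%:E.

Definition sigma_seq (d' : measure_display) (T' : measurableType d')
    (Y : nat -> Omega -> T') : set_system Omega :=
  <<s \bigcup_j g_sigma_algebra_preimage (Y j) >>.

(* p is a version of the conditional probability P(A | G) *)
Definition conditional_probability (G : set_system Omega) (A : set Omega)
    (p : Omega -> R) :=
  [/\ forall B, measurable B -> G (p @^-1` B),
      P.-integrable setT (EFin \o p) &
      forall C, G C -> (\int[P]_(w in C) (p w)%:E = P (A `&` C))%E].

Definition cvg_in_law (Y : nat -> Omega -> R)
    (mu : probability (measurableTypeR R) R) :=
  (forall n, measurable_fun setT (Y n)) /\
  forall g : R -> R, continuous g -> (exists M, forall x, `|g x| <= M) ->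
    'E_P[g \o Y n]%E @[n --> \oo] --> (\int[mu]_x (g x)%:E)%E.

End laws_and_independence.

(* The case distinction is needed because normal_prob 0 0 is not the Dirac
   mass at 0 but the uniform law on [0, 1]. *)
Definition centered_gaussian (R : realType) (s2 : R) :
    probability (measurableTypeR R) R :=
  if s2 == 0 then (\d_(0 : measurableTypeR R) : probability _ R)
  else (normal_prob 0 (Num.sqrt s2) : probability _ R).

Section vectors.
Context (R : realType) (k : nat).

Definition vle (s t : k.-tuple R) : bool := [forall i, tnth s i <= tnth t i].

Definition mcdf (dO : measure_display) (Omega : measurableType dO)
    (P : probability Omega R) (Z : Omega -> k.-tuple R) (t : k.-tuple R) : R :=
  fine (P [set w | vle (Z w) t]).

(* The samples are indexed from 0. *)
Definition CVM_estimator (Omega : Type) (Z1 Z2 W : nat -> Omega -> k.-tuple R)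
    (N : nat) (w : Omega) : R :=
  N%:R^-1 * \sum_(l < N)
    (N%:R^-1 * (\sum_(j < N)
       (vle (Z1 j w) (W l w))%:R * (vle (Z2 j w) (W l w))%:R)
     - ((2 * N%:R)^-1 * \sum_(j < N)
          ((vle (Z1 j w) (W l w))%:R + (vle (Z2 j w) (W l w))%:R)) ^+ 2).

End vectors.

(* Main.v *)
Require Import Defs.
From mathcomp Require Import all_boot all_order all_algebra finmap.
From mathcomp Require Import all_classical all_reals all_analysis.
From mathcomp Require Import measurable_realfun ring lra.

Set Implicit Arguments.
Unset Strict Implicit.
Unset Printing Implicit Defensive.

Import Order.TTheory GRing.Theory Num.Theory.
Import numFieldNormedType.Exports.

Local Open Scope classical_set_scope.
Local Open Scope ring_scope.

(** Write [s] for the average of the two indicators of [{Z1 <= t}], [{Z2 <= t}]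
    and [e] for their product. With [F t = E s(Z0, t)] and [G t = E e(Z0, t)],
    expanding the square around [F(W_l)] shows that
    [sqrt N * (estimator - (E G(W) - E F(W)^2))] is
    [N^(-1/2) * sum_j (a(Z_j) + b(W_j))], where [a(Z_j)] is [V - E V] and [b(W_j)]
    is [U - E U] evaluated at the [j]-th copies, up to a remainder made of a doubly
    centered sum over pairs [(j, l)] and of squares of conditionally centered
    averages; by orthogonality its L1 norm is O(N^(-1/2)).

    The linear part obeys the central limit theorem by Lindeberg replacement:
    convolution by a Gaussian law preserves the test functions having a uniform
    second order Taylor expansion, and Gaussian laws form a convolution
    semigroup. Iterated antiderivatives followed by difference quotients
    approximate bounded Lipschitz functions by such test functions, and infimal
    convolutions approximate bounded continuous functions by Lipschitz ones.

    Finally [E F^v(t)^2 = G t], because [Z2] is a conditionally independent copy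
    of [Z1] given [X_v]; hence the limit [E G(W) - E F(W)^2] is [N2]. *)

(** * Bounded measurable functions *)

(** The obstacle is the square in the estimator: every [W_l] is compared with all the pairs, so the
    statistic is not an average of independent terms. For fixed [W_l] the average of [s] fluctuates
    around [F(W_l)] by order N^(-1/2). The square of this fluctuation has mean of order 1/N and does
    not survive the factor sqrt N; the first-order term does, with coefficient [2 * F], whence the
    product of [F(t)] with the sum of the two indicators in [V]. The two projections depend on
    different samples, so their variances add. Lindeberg replacement suits this setting because it
    asks of a summand only two identities, for its first and second moments against functions of the
    preceding partial sum, and both follow from integrating out one variable at a time. All random
    quantities are bounded; unbounded moments occur on the Gaussian side alone and come from
    explicit exponential integrals. The limit variance may vanish, so the Dirac mass is carried
    along as the Gaussian law of variance 0. *)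

Lemma measurable_preimageT d1 d2 (T1 : measurableType d1)
    (T2 : measurableType d2) (f : T1 -> T2) (B : set T2) :
  measurable_fun setT f -> measurable B -> measurable (f @^-1` B).
Proof. by move=> mf mB; rewrite -[X in measurable X]setTI; exact: mf. Qed.

(* Bounded measurable functions: every integrand below is one of these, so that
   integrability side conditions disappear. *)
Definition bmf d (T : measurableType d) (R : realType) (f : T -> R) :=
  measurable_fun setT f /\ exists M : R, forall x, `|f x| <= M.

Section bmf_closure.
Context d (T : measurableType d) (R : realType).
Implicit Types f g : T -> R.

Lemma bmf_measurable f : bmf f -> measurable_fun setT f.
Proof. by case. Qed.

Lemma bmf_bound f : bmf f -> exists2 M : R, 0 < M & forall x, `|f x| <= M.
Proof.
move=> [_ [M fM]]; exists (`|M| + 1); first by rewrite ltr_wpDl.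
by move=> x; rewrite (le_trans (fM x))// (le_trans (ler_norm _))// lerDl.
Qed.

Lemma bmf_cst (c : R) : bmf (fun _ : T => c).
Proof. by split; [exact: measurable_cst|exists `|c|]. Qed.

Lemma bmfD f g : bmf f -> bmf g -> bmf (fun x => f x + g x).
Proof.
move=> [mf [M fM]] [mg [N gN]]; split; first exact: measurable_funD.
by exists (M + N) => x; rewrite (le_trans (ler_normD _ _))// lerD.
Qed.

Lemma bmfN f : bmf f -> bmf (fun x => - f x).
Proof.
move=> [mf [M fM]]; split; first exact: measurableT_comp.
by exists M => x; rewrite normrN.
Qed.

Lemma bmfB f g : bmf f -> bmf g -> bmf (fun x => f x - g x).
Proof. by move=> bf bg; apply: bmfD => //; exact: bmfN. Qed.

Lemma bmfM f g : bmf f -> bmf g -> bmf (fun x => f x * g x).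
Proof.
move=> [mf [M fM]] [mg [N gN]]; split; first exact: measurable_funM.
by exists (M * N) => x; rewrite normrM ler_pM.
Qed.

Lemma bmfX n f : bmf f -> bmf (fun x => f x ^+ n).
Proof.
move=> bf; elim: n => [|n ih]; first exact: bmf_cst.
by under [X in bmf X]eq_fun do rewrite exprS; exact: bmfM.
Qed.

Lemma bmf_norm f : bmf f -> bmf (fun x => `|f x|).
Proof.
move=> [mf [M fM]]; split; first exact: measurableT_comp.
by exists M => x; rewrite normr_id.
Qed.

Lemma bmf_sum (I : Type) (s : seq I) (F : I -> T -> R) :
  (forall i, bmf (F i)) -> bmf (fun x => \sum_(i <- s) F i x).
Proof.
move=> bF; elim: s => [|i s ih].
  by under [X in bmf X]eq_fun do rewrite big_nil; exact: bmf_cst.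
by under [X in bmf X]eq_fun do rewrite big_cons; exact: bmfD.
Qed.

Lemma bmf_bool (b : T -> bool) : measurable_fun setT b ->
  bmf (fun x => (b x)%:R : R).
Proof.
move=> mb; split; last by exists 1 => x; case: (b x); rewrite ?normr1 ?normr0.
by apply: (@measurableT_comp _ _ _ _ _ _ (fun b : bool => b%:R : R) _ b).
Qed.

Lemma bmf_indic (A : set T) : measurable A -> bmf (\1_A : T -> R).
Proof.
move=> mA; split; first exact: measurable_indic.
by exists 1 => x; rewrite indicE; case: (_ \in _); rewrite ?normr1 ?normr0.
Qed.

Lemma bmf_comp d' (T' : measurableType d') (h : T' -> R) (f : T -> T') :
  bmf h -> measurable_fun setT f -> bmf (fun x => h (f x)).
Proof.
by move=> [mh [M hM]] mf; split; [exact: (measurableT_comp mh mf)|exists M].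
Qed.

End bmf_closure.

Section expectation_bmf.
Context d (T : measurableType d) (R : realType) (P : probability T R).
Implicit Types f g : T -> R.

Lemma bmf_integrable f : bmf f -> P.-integrable setT (EFin \o f).
Proof.
move=> [mf [M fM]]; apply: measurable_bounded_integrable => //.
  by rewrite (le_lt_trans (probability_le1 P measurableT)) ?ltry.
exists M; split; first exact: num_real.
by move=> N MN x _; apply: (le_trans (fM x)); exact: ltW.
Qed.
Hint Resolve bmf_integrable : core.

Lemma bmf_integral f : bmf f -> (\int[P]_x (f x)%:E = (\int[P]_x f x)%:E)%E.
Proof.
move=> bf; rewrite /Rintegral fineK//.
exact: integrable_fin_num (bmf_integrable bf).
Qed.

Lemma bmf_expectation f : bmf f -> ('E_P[f] = (\int[P]_x f x)%:E)%E.
Proof. by move=> bf; rewrite unlock bmf_integral. Qed.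

Lemma prob_Rintegral_cst (c : R) : \int[P]_x c = c.
Proof.
rewrite Rintegral_cst//.
exact: etrans (congr1 (fun z => c * fine z) (probability_setT P)) (mulr1 c).
Qed.

Lemma bmf_RintegralD f g : bmf f -> bmf g ->
  \int[P]_x (f x + g x) = \int[P]_x f x + \int[P]_x g x.
Proof. by move=> bf bg; rewrite RintegralD//; exact: bmf_integrable. Qed.

Lemma bmf_RintegralB f g : bmf f -> bmf g ->
  \int[P]_x (f x - g x) = \int[P]_x f x - \int[P]_x g x.
Proof. by move=> bf bg; rewrite RintegralB//; exact: bmf_integrable. Qed.

Lemma bmf_RintegralZl f (c : R) : bmf f ->
  \int[P]_x (c * f x) = c * \int[P]_x f x.
Proof. by move=> bf; rewrite RintegralZl//; exact: bmf_integrable. Qed.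

Lemma bmf_RintegralZr f (c : R) : bmf f ->
  \int[P]_x (f x * c) = \int[P]_x f x * c.
Proof. by move=> bf; rewrite RintegralZr//; exact: bmf_integrable. Qed.

Lemma bmf_Rintegral_sum (I : Type) (s : seq I) (F : I -> T -> R) :
  (forall i, bmf (F i)) ->
  \int[P]_x (\sum_(i <- s) F i x) = \sum_(i <- s) \int[P]_x F i x.
Proof.
move=> bF; elim: s => [|i s ih].
  rewrite big_nil -[RHS](prob_Rintegral_cst 0).
  by apply: eq_Rintegral => x _; rewrite big_nil.
rewrite big_cons -ih -bmf_RintegralD//; last exact: bmf_sum.
by apply: eq_Rintegral => x _; rewrite big_cons.
Qed.

Lemma bmf_le_Rintegral f g : bmf f -> bmf g -> (forall x, f x <= g x) ->
  \int[P]_x f x <= \int[P]_x g x.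
Proof. by move=> bf bg fg; apply: le_Rintegral => //; exact: bmf_integrable. Qed.

Lemma bmf_ler_norm_Rintegral f : bmf f ->
  `|\int[P]_x f x| <= \int[P]_x `|f x|.
Proof. by move=> bf; apply: le_normr_Rintegral => //; exact: bmf_integrable. Qed.

Lemma bmf_Rintegral_bound f M : bmf f -> (forall x, `|f x| <= M) ->
  `|\int[P]_x f x| <= M.
Proof.
move=> bf fM; rewrite (le_trans (bmf_ler_norm_Rintegral bf))//.
rewrite -[leRHS]prob_Rintegral_cst.
by apply: bmf_le_Rintegral => //; [exact: bmf_norm|exact: bmf_cst].
Qed.

Lemma Rintegral_indic_prob (A : set T) : measurable A ->
  \int[P]_x \1_A x = fine (P A).
Proof. by move=> mA; rewrite /Rintegral integral_indic// setIT. Qed.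

End expectation_bmf.
#[global] Hint Resolve bmf_cst : core.

(** [P] and [Q] may live on different spaces: this serves to compare the law of a pair on [T] with a
    law on [T * T], and [dF] on vectors with [W] on [Omega]. *)
Lemma Rintegral_law d1 d2 d (T1 : measurableType d1) (T2 : measurableType d2)
    (T : measurableType d) (R : realType) (P : probability T1 R)
    (Q : probability T2 R) (X : T1 -> T) (Y : T2 -> T) (f : T -> R) :
  measurable_fun setT X -> measurable_fun setT Y ->
  (forall B, measurable B -> P (X @^-1` B) = Q (Y @^-1` B)) ->
  bmf f -> \int[P]_x f (X x) = \int[Q]_y f (Y y).
Proof.
move=> mX mY XY bf; rewrite /Rintegral; congr fine.
have mf : measurable_fun setT (EFin \o f) by apply/measurable_EFinP; case: bf.
have iX := bmf_integrable P (bmf_comp bf mX).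
have iY := bmf_integrable Q (bmf_comp bf mY).
transitivity (\int[pushforward P X]_y (f y)%:E)%E.
  exact: (esym (integral_pushforward mX mf iX measurableT)).
rewrite -[RHS](integral_pushforward mY mf iY measurableT).
by apply: eq_measure_integral => A mA _; exact: XY.
Qed.

Section fubini_bmf.
Context d1 d2 (T1 : measurableType d1) (T2 : measurableType d2) (R : realType)
  (P : probability T1 R) (Q : probability T2 R) (f : T1 * T2 -> R).
Hypothesis bf : bmf f.

Lemma bmf_pairr x : bmf (fun y => f (x, y)).
Proof. by apply: (bmf_comp bf); exact: measurable_fun_pair. Qed.

Lemma bmf_pairl y : bmf (fun x => f (x, y)).
Proof. by apply: (bmf_comp bf); exact: measurable_fun_pair. Qed.

Lemma bmf_integrable_prod :
  ((P \x Q)%E : probability _ R).-integrable setT (EFin \o f).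
Proof. exact: (bmf_integrable ((P \x Q)%E : probability _ R) bf). Qed.

Lemma bmf_fubini1 :
  \int[((P \x Q)%E : probability _ R)]_z f z = \int[P]_x \int[Q]_y f (x, y).
Proof.
rewrite {1}/Rintegral -(integral12_prod_meas1 bmf_integrable_prod) {2}/Rintegral.
congr fine; apply: eq_integral => x _.
by rewrite -bmf_integral//; exact: bmf_pairr.
Qed.

Lemma bmf_fubini2 :
  \int[((P \x Q)%E : probability _ R)]_z f z = \int[Q]_y \int[P]_x f (x, y).
Proof.
rewrite {1}/Rintegral -(integral21_prod_meas1 bmf_integrable_prod) {2}/Rintegral.
congr fine; apply: eq_integral => x _.
by rewrite -bmf_integral//; exact: bmf_pairl.
Qed.

End fubini_bmf.

Lemma bmf_Rintegralr d1 d2 (T1 : measurableType d1) (T2 : measurableType d2)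
    (R : realType) (Q : probability T2 R) (f : T1 * T2 -> R) :
  bmf f -> bmf (fun x => \int[Q]_y f (x, y)).
Proof.
move=> bf; split.
  (* Measurability of the partial integral involves no measure on [T1]; the Dirac mass only
     completes the product on which Fubini's theorem is stated. *)
  have P : probability T1 R := \d_point.
  have mF := measurable_fubini_F (bmf_integrable_prod P Q bf).
  exact: (measurableT_comp (fine_measurable measurableT) mF).
have [M _ fM] := bmf_bound bf; exists M => x.
by apply: bmf_Rintegral_bound => //; exact: bmf_pairr.
Qed.

(** Independence says that the law of [(Y, Z)] under [P] and the law of [h] under [P \x P] agree on
    rectangles, and uniqueness of the product measure does the rest. An independent copy of [Z] is
    thus obtained by integrating over a second point [w'] of the same space. *)
Lemma indep_Rintegral d d1 d2 (T : measurableType d) (T1 : measurableType d1)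
    (T2 : measurableType d2) (R : realType) (P : probability T R)
    (Y : T -> T1) (Z : T -> T2) (H : T1 * T2 -> R) :
  measurable_fun setT Y -> measurable_fun setT Z ->
  independent2 P (g_sigma_algebra_preimage Y) (g_sigma_algebra_preimage Z) ->
  bmf H -> \int[P]_w H (Y w, Z w) = \int[P]_w \int[P]_w' H (Y w, Z w').
Proof.
move=> mY mZ YZ bH.
pose h (z : T * T) := (Y z.1, Z z.2).
have mh : measurable_fun setT h.
  by apply: measurable_fun_pair; apply: measurableT_comp.
have mYZ : measurable_fun setT (fun w => (Y w, Z w)).
  exact: measurable_fun_pair.
rewrite -(bmf_fubini1 P P (bmf_comp bH mh)).
apply: (@Rintegral_law _ _ _ _ _ _ _ P ((P \x P)%E : probability _ R) _ h) => //.
move=> B mB.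
pose Q1 : probability _ _ := distribution P (mfun_Sub (mem_set mY)).
pose Q2 : probability _ _ := distribution P (mfun_Sub (mem_set mZ)).
pose m1 := pushforward P (fun w => (Y w, Z w)).
pose m2 := pushforward (P \x P)%E h.
transitivity ((Q1 \x Q2)%E B).
  apply/esym; apply: (@product_measure_unique _ _ _ _ _ Q1 Q2 m1) => //.
  move=> A C mA mC.
  by apply: YZ; [exists A => //; rewrite setTI|exists C => //; rewrite setTI].
apply: (@product_measure_unique _ _ _ _ _ Q1 Q2 m2) => //.
move=> A C mA mC.
apply: (product_measure1E P P (A1 := Y @^-1` A) (A2 := Z @^-1` C)).
  exact: measurable_preimageT.
exact: measurable_preimageT.
Qed.

(** * Independence of sigma-algebras *)

Section pi_lambda_independence.
Context d (T : measurableType d) (R : realType) (P : probability T R).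

Lemma independent2C (G H : set_system T) :
  independent2 P G H -> independent2 P H G.
Proof. by move=> GH A B HA GB; rewrite setIC GH// muleC. Qed.

Lemma independent2S (G G' H H' : set_system T) : G `<=` G' -> H `<=` H' ->
  independent2 P G' H' -> independent2 P G H.
Proof. by move=> GG' HH' GH A B /GG' GA /HH' HB; exact: GH. Qed.

(** For fixed [B], both sides of the product formula are finite measures in [A]: the restriction of
    [P] to [B], and [P] scaled by [P B]. They agree on the pi-system [G], hence on what it
    generates. *)
Lemma independent2_gl (G H : set_system T) : G `<=` measurable ->
  H `<=` measurable -> setI_closed G -> G setT ->
  independent2 P G H -> independent2 P <<s G>> H.
Proof.
move=> mG mH GI GT GH A B sGA HB.
have mB := mH _ HB.
have PB0 : 0 <= fine (P B) by rewrite fine_ge0.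
pose m1 := mrestr P mB.
pose m2 := mscale (NngNum PB0) P.
suff : m1 A = m2 A.
  by rewrite /m1 /m2 /mrestr /mscale/= fineK ?fin_num_measure// muleC.
apply: (@g_sigma_algebra_measure_unique _ _ _ G mG (fun=> setT)) => //.
- by rewrite bigcup_const.
- move=> C GC; transitivity (P (C `&` B)); first by [].
  transitivity ((fine (P B))%:E * P C)%E; last by [].
  by rewrite fineK ?fin_num_measure// muleC GH.
- move=> _; change (P (setT `&` B) < +oo)%E; rewrite setTI.
  by rewrite (le_lt_trans (probability_le1 P mB)) ?ltry.
Qed.

Lemma sub_gen_measurable (G : set_system T) : G `<=` measurable ->
  <<s G>> `<=` measurable.
Proof. by move=> mG; apply: smallest_sub => //; exact: sigma_algebra_measurable. Qed.

Lemma independent2_g (G H : set_system T) : G `<=` measurable ->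
  H `<=` measurable -> setI_closed G -> setI_closed H -> G setT -> H setT ->
  independent2 P G H -> independent2 P <<s G>> <<s H>>.
Proof.
move=> mG mH GI HI GT HT GH; apply/independent2C/independent2_gl => //.
  exact: sub_gen_measurable.
by apply/independent2C/independent2_gl.
Qed.

End pi_lambda_independence.

Section blocks.
Context d (T : measurableType d) (R : realType) (P : probability T R)
  (I : choiceType) (F : I -> set_system T).
Hypothesis sF : forall i, sigma_algebra setT (F i).
Hypothesis mF : forall i, F i `<=` measurable.

Let FT i : F i setT.
Proof. by have [F0 FC _] := sF i; rewrite -(setD0 setT); exact: FC. Qed.

Let FI i : setI_closed (F i).
Proof.
move=> A B FA FB; have := sigma_algebra_id (sF i) => FE.
rewrite -FE; rewrite -FE in FA FB.
exact: (@measurableI _ (g_sigma_algebraType (F i))).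
Qed.

(** The sets [A i] are given for every [i] and equal [setT] off the finite support, so rectangles
    with different supports intersect coordinatewise and form a pi-system. *)
Definition finite_rectangles (J : set I) : set_system T :=
  [set C | exists (K : {fset I}) (A : I -> set T),
    [/\ [set` K] `<=` J, forall i, F i (A i),
        forall i, i \notin K -> A i = setT & C = \bigcap_i A i]].

Lemma finite_rectanglesT J : finite_rectangles J setT.
Proof.
exists fset0, (fun=> setT); split => //; last by rewrite bigcapT.
Qed.

Lemma bigcap_support (K : {fset I}) (A : I -> set T) :
  (forall i, i \notin K -> A i = setT) ->
  \bigcap_i A i = \bigcap_(i in [set` K]) A i.
Proof.
move=> AT; apply/seteqP; split=> [x Ax i _|x Ax i _]; first exact: Ax.
by have [iK|/AT ->//] := boolP (i \in K); exact: Ax.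
Qed.

Lemma finite_rectangles_measurable J : finite_rectangles J `<=` measurable.
Proof.
move=> _ [K [A [_ FA AT ->]]]; rewrite (bigcap_support AT) bigcap_fset.
by apply: bigsetI_measurable => i _; exact: mF.
Qed.

Lemma finite_rectanglesI J : setI_closed (finite_rectangles J).
Proof.
move=> _ _ [K1 [A1 [KJ1 FA1 AT1 ->]]] [K2 [A2 [KJ2 FA2 AT2 ->]]].
exists (K1 `|` K2)%fset, (fun i => A1 i `&` A2 i); split.
- by move=> i /=; rewrite inE => /orP[/KJ1|/KJ2].
- by move=> i; exact: FI.
- by move=> i; rewrite inE negb_or => /andP[/AT1 -> /AT2 ->]; rewrite setTI.
- by rewrite bigcapI.
Qed.

Lemma gen_finite_rectangles (J : set I) :
  <<s \bigcup_(i in J) F i>> `<=` <<s finite_rectangles J>>.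
Proof.
apply: smallest_sub; first exact: smallest_sigma_algebra.
move=> A [i Ji FiA]; apply: sub_sigma_algebra.
exists [fset i]%fset, (fun j => if j == i then A else setT); split.
- by move=> j /=; rewrite inE => /eqP ->.
- by move=> j; case: eqP => [->|].
- by move=> j; rewrite inE => /negbTE ->.
- apply/seteqP; split=> [x Ax j _|x /(_ i Logic.I)]; last by rewrite eqxx.
  by case: eqP.
Qed.

(** Two rectangles and their intersection are written over the union of the supports. Since the
    blocks are disjoint, at each index at most one of the two sets differs from [setT], and the
    product of probabilities splits factor by factor. *)
Lemma independent_blocks (D J1 J2 : set I) : independent P D F ->
  J1 `<=` D -> J2 `<=` D -> J1 `&` J2 = set0 ->
  independent2 P <<s \bigcup_(i in J1) F i>> <<s \bigcup_(i in J2) F i>>.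
Proof.
move=> ind J1D J2D J12.
apply: (independent2S (@gen_finite_rectangles J1) (@gen_finite_rectangles J2)).
apply: independent2_g; [exact: finite_rectangles_measurable..|
  exact: finite_rectanglesI|exact: finite_rectanglesI|
  exact: finite_rectanglesT|exact: finite_rectanglesT|].
move=> _ _ [K1 [A1 [KJ1 FA1 AT1 ->]]] [K2 [A2 [KJ2 FA2 AT2 ->]]].
pose K := (K1 `|` K2)%fset.
have KD : [set` K] `<=` D.
  by move=> i /=; rewrite inE => /orP[/KJ1/J1D|/KJ2/J2D].
have AT1' i : i \notin K -> A1 i = setT.
  by rewrite inE negb_or => /andP[/AT1].
have AT2' i : i \notin K -> A2 i = setT.
  by rewrite inE negb_or => /andP[_ /AT2].
rewrite -bigcapI !(@bigcap_support K)//; last first.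
  by move=> i iK; rewrite AT1'// AT2'// setTI.
rewrite !(ind K)//; [|by move=> i _; exact: FI].
rewrite -EFinM -big_split/=; congr (_%:E); apply: eq_bigr => i _.
have PT : fine (P setT) = 1 by exact: (congr1 fine (probability_setT P)).
have [iK1|/AT1 ->] := boolP (i \in K1); last by rewrite setTI PT mul1r.
have [iK2|/AT2 ->] := boolP (i \in K2); last by rewrite setIT PT mulr1.
by have : (J1 `&` J2) i; [split; [exact: KJ1|exact: KJ2]|rewrite J12].
Qed.

End blocks.

(** Here [G1] stands for one copy, [G2] for the other copies of its sequence, [A] for the whole
    sequence and [B] for the other sample. The sets [g] meet [b] form a pi-system; since [A]
    contains the intersections of members of [G1] and [G2], independence from [B] is applied before
    that of [G1] and [G2]. *)
Lemma independent2_join d (T : measurableType d) (R : realType)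
    (P : probability T R) (G1 G2 A B : set_system T) :
  sigma_algebra setT G2 -> sigma_algebra setT B -> setI_closed A ->
  G1 `<=` A -> G2 `<=` A -> A `<=` measurable -> B `<=` measurable ->
  independent2 P G1 G2 -> independent2 P A B ->
  independent2 P G1 <<s G2 `|` B>>.
Proof.
move=> sG2 sB AI G1A G2A mA mB G12 AB.
have algT (G : set_system T) : sigma_algebra setT G -> G setT.
  by move=> [G0 GC _]; rewrite -(setD0 setT); exact: GC.
have algI (G : set_system T) : sigma_algebra setT G -> setI_closed G.
  move=> sG C D; rewrite -(sigma_algebra_id sG) => GC GD.
  exact: (@measurableI _ (g_sigma_algebraType G)).
pose H := [set C | exists g b, [/\ G2 g, B b & C = g `&` b]].
apply: (@independent2S _ _ _ _ G1 G1 _ <<s H>>) => //.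
  apply: smallest_sub; first exact: smallest_sigma_algebra.
  move=> C [G2C|BC]; apply: sub_sigma_algebra.
    by exists C, setT; split => //; [exact: algT|rewrite setIT].
  by exists setT, C; split => //; [exact: algT|rewrite setTI].
apply/independent2C/independent2_gl.
- by move=> _ [g [b [/G2A/mA mg /mB mb ->]]]; exact: measurableI.
- by move=> C /G1A/mA.
- move=> _ _ [g [b [Gg Bb ->]]] [g' [b' [Gg' Bb' ->]]].
  exists (g `&` g'), (b `&` b'); split; [exact: algI|exact: algI|].
  by rewrite setIACA.
- by exists setT, setT; split; [exact: algT..|rewrite setTI].
- move=> _ a [g [b [Gg Bb ->]]] G1a.
  rewrite setIC setIA AB//; last by apply: AI; [exact: G1A|exact: G2A].
  by rewrite (G12 _ _ G1a Gg) (AB _ _ (G2A _ Gg) Bb) -muleA muleC.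
Qed.

Lemma ler_eps (R : realType) (a b c : R) :
  (forall e, 0 < e < 1 -> a <= b + e * c) -> a <= b.
Proof.
move=> H; rewrite leNgt; apply/negP => ba.
have c0 : 0 < `|c| + 1 by rewrite ltr_wpDl.
(* The first entry keeps [e < 1], the second makes [e * c] at most half the gap [a - b]; adding 1 to
   the norm of [c] covers [c = 0]. *)
pose e := Num.min (2^-1) ((a - b) / (2 * (`|c| + 1))).
have e0 : 0 < e.
  by rewrite lt_min invr_gt0 ltr0n/= divr_gt0 ?subr_gt0 ?mulr_gt0.
have e1 : e < 1 by rewrite gt_min; apply/orP; left; lra.
have := H e; rewrite e0 e1 => /(_ isT).
have ec : e * c <= (a - b) / 2.
  have le_e : e <= (a - b) / (2 * (`|c| + 1)) by rewrite ge_min lexx orbT.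
  apply: (@le_trans _ _ (e * (`|c| + 1))).
    by rewrite ler_pM2l// (le_trans (ler_norm c))// lerDl.
  rewrite (le_trans (ler_wpM2r (ltW c0) le_e))//.
  by rewrite invfM mulrA mulfVK// gt_eqF.
lra.
Qed.

(** * Gaussian integrals *)

Section normal_integral.
Context (R : realType).
Local Notation mu := (@lebesgue_measure R).
Implicit Types (m s x y : R).

(** The Radon-Nikodym derivative agrees almost everywhere with [normal_pdf], because both have the
    same integral over every measurable set. *)
Lemma ge0_integral_normal m s (f : R -> \bar R) :
  measurable_fun setT f -> (forall x, 0 <= f x)%E ->
  (\int[normal_prob m s]_x f x = \int[mu]_x (f x * (normal_pdf m s x)%:E))%E.
Proof.
move=> mf f0.
have dom := normal_prob_dominates m s.
rewrite -(Radon_Nikodym_SigmaFinite.change_of_variables dom f0 measurableT mf).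
apply: ae_eq_integral => //.
- apply: emeasurable_funM => //; apply: (measurable_int mu).
  exact: Radon_Nikodym_SigmaFinite.f_integrable.
- apply: emeasurable_funM => //; apply/measurable_EFinP.
  exact: measurable_normal_pdf.
- apply: ae_eqe_mul2l => /=; apply: integral_ae_eq => //.
  + exact: Radon_Nikodym_SigmaFinite.f_integrable.
  + by apply/measurable_EFinP; exact: measurable_normal_pdf.
  + move=> A AT mA.
    exact/esym/(Radon_Nikodym_SigmaFinite.f_integral dom).
Qed.

Lemma ge0_integral_shift (f : R -> \bar R) y :
  measurable_fun setT f -> (forall x, 0 <= f x)%E ->
  (\int[mu]_x f (x + y)%R = \int[mu]_x f x)%E.
Proof.
move=> mf f0.
have mD : measurable_fun setT ((fun x => x + y) : R -> measurableTypeR R).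
  exact: measurable_funD.
transitivity (\int[pushforward mu ((fun x => (x + y)%R) : R -> measurableTypeR R)]_x f x)%E.
  by rewrite ge0_integral_pushforward.
apply: eq_measure_integral => A mA _; apply/esym.
apply: lebesgue_measure_unique => // _ [[a b]] _ <-.
rewrite /= /pushforward.
rewrite (_ : _ @^-1` _ = `]a - y, b - y]%classic); last first.
  by apply/seteqP; split => x /=; rewrite !in_itv/= ltrBlDr lerBrDr.
rewrite !lebesgue_measure_itv/= !lte_fin ltrD2r.
by case: ifP => // _; rewrite -!EFinB; congr (_%:E); ring.
Qed.

(** The exponents add up to [- r ^+ 2 * y ^+ 2 / (2 * s ^+ 2)], that of standard deviation [s / r].
    Writing the coefficient as [1 - r ^+ 2] makes the total mass [r^-1], free of square roots. *)
Lemma normal_pdf_expsq s r y : 0 < s -> 0 < r ->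
  expR ((1 - r ^+ 2) * (y ^+ 2 / (2 * s ^+ 2))) * normal_pdf 0 s y =
  r^-1 * normal_pdf 0 (s / r) y.
Proof.
move=> s0 r0.
rewrite !normal_pdfE ?gt_eqF ?divr_gt0//.
rewrite mulrCA -expRD [RHS]mulrA; congr (_ * expR _); last first.
  by field; rewrite !gt_eqF.
rewrite /normal_peak -invfM; congr (_ ^-1).
rewrite -{1}(ger0_norm (ltW r0)) -sqrtr_sqr -sqrtrM ?sqr_ge0//.
by congr Num.sqrt; field; rewrite !gt_eqF.
Qed.

Lemma normal_pdf_explin s h y : 0 < s ->
  expR (h * y) * normal_pdf 0 s y =
  expR (h ^+ 2 * s ^+ 2 / 2) * normal_pdf (h * s ^+ 2) s y.
Proof.
move=> s0; rewrite !normal_pdfE ?gt_eqF//.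
rewrite mulrCA -expRD [RHS]mulrCA -expRD; congr (_ * expR _).
by field; rewrite !gt_eqF.
Qed.

(** The joint density of two independent centered Gaussians, factored as the density of their sum
    [w] times the conditional density of the first given [w]. *)
Lemma normal_pdf_conv s t u w y : 0 < s -> 0 < t -> 0 < u ->
  u ^+ 2 = s ^+ 2 + t ^+ 2 ->
  normal_pdf 0 s y * normal_pdf 0 t (w - y) =
  normal_pdf 0 u w * normal_pdf (w * s ^+ 2 / u ^+ 2) (s * t / u) y.
Proof.
move=> s0 t0 u0 ust.
rewrite !normal_pdfE ?gt_eqF ?divr_gt0 ?mulr_gt0//.
rewrite mulrACA [RHS]mulrACA -!expRD; congr (_ * expR _).
  rewrite /normal_peak -!invfM -!sqrtrM; last 2 first.
  - by rewrite mulrn_wge0// mulr_ge0 ?sqr_ge0 ?pi_ge0.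
  - by rewrite mulrn_wge0// mulr_ge0 ?sqr_ge0 ?pi_ge0.
  by congr (Num.sqrt _)^-1; field; rewrite !gt_eqF.
have -> : (w - y - 0) ^+ 2 = (w - y) ^+ 2 by rewrite subr0.
have t2 : t ^+ 2 = u ^+ 2 - s ^+ 2 by rewrite ust; ring.
have t20 : u ^+ 2 - s ^+ 2 != 0 by rewrite -t2 gt_eqF// exprn_gt0.
rewrite !exprMn exprVn t2.
by field; rewrite t20 !gt_eqF.
Qed.

Lemma measurable_expsq (c s : R) :
  measurable_fun setT (fun y : R => expR (c * (y ^+ 2 / s))).
Proof.
apply: measurableT_comp => //; apply: measurable_funM => //.
by apply: measurable_funM => //; exact: measurable_funX.
Qed.

Lemma integral_normal_expsq s r : 0 < s -> 0 < r ->
  (\int[normal_prob 0 s]_y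
     (expR ((1 - r ^+ 2) * (y ^+ 2 / (2 * s ^+ 2))))%:E = r^-1%:E)%E.
Proof.
move=> s0 r0; rewrite ge0_integral_normal; last 2 first.
- by apply/measurable_EFinP; exact: measurable_expsq.
- by move=> x; rewrite lee_fin expR_ge0.
under eq_integral do rewrite -EFinM normal_pdf_expsq// EFinM.
rewrite integralZl//; last exact: integrable_normal_pdf.
by rewrite integral_normal_pdf mule1.
Qed.

Lemma integral_normal_explin s h : 0 < s ->
  (\int[normal_prob 0 s]_y (expR (h * y))%:E =
   (expR (h ^+ 2 * s ^+ 2 / 2))%:E)%E.
Proof.
move=> s0; rewrite ge0_integral_normal; last 2 first.
- by apply/measurable_EFinP; apply: measurableT_comp.
- by move=> x; rewrite lee_fin expR_ge0.
under eq_integral do rewrite -EFinM normal_pdf_explin// EFinM.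
rewrite integralZl//; last exact: integrable_normal_pdf.
by rewrite integral_normal_pdf mule1.
Qed.

(** After a translation and an exchange of integrals, the inner integral runs over the conditional
    density of [normal_pdf_conv] and equals 1. Nonnegative extended-real [f] allow Tonelli without
    integrability conditions. *)
Lemma normal_convolution s t u (f : R -> \bar R) :
  0 < s -> 0 < t -> 0 < u -> u ^+ 2 = s ^+ 2 + t ^+ 2 ->
  measurable_fun setT f -> (forall x, 0 <= f x)%E ->
  (\int[normal_prob 0 s]_y \int[normal_prob 0 t]_z f (y + z)%R
   = \int[normal_prob 0 u]_w f w)%E.
Proof.
move=> s0 t0 u0 ust mf f0.
have mfs y : measurable_fun setT (fun z => f (y + z)).
  by apply: measurableT_comp => //; exact: measurable_funD.
have pdf_ge0 (m v x : R) : (0 <= (normal_pdf m v x)%:E)%E.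
  by rewrite lee_fin normal_pdf_ge0.
have mpdf (m v : R) : measurable_fun setT (normal_pdf m v).
  exact: measurable_normal_pdf.
pose k (z : R * R) : \bar R :=
  (f z.2 * (normal_pdf 0 t (z.2 - z.1))%:E * (normal_pdf 0 s z.1)%:E)%E.
have mk : measurable_fun setT k.
  apply: emeasurable_funM; last first.
    by apply/measurable_EFinP; apply: measurableT_comp.
  apply: emeasurable_funM; first by apply: measurableT_comp.
  apply/measurable_EFinP; apply: (measurableT_comp (mpdf _ _)).
  exact: measurable_funB.
have k0 z : (0 <= k z)%E by rewrite /k !mule_ge0.
have inner y : (\int[normal_prob 0 t]_z f (y + z)%R =
    \int[mu]_w (f w * (normal_pdf 0 t (w - y))%:E))%E.
  rewrite (ge0_integral_normal _ _ (mfs y)); last by [].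
  rewrite -[RHS](@ge0_integral_shift _ y).
  - by apply: eq_integral => z _; rewrite addrK addrC.
  - apply: emeasurable_funM => //; apply/measurable_EFinP.
    apply: measurableT_comp => //; exact: measurable_funB.
  - by move=> x; rewrite mule_ge0.
have mG : measurable_fun setT
    (fun y => \int[mu]_w (f w * (normal_pdf 0 t (w - y))%:E))%E.
  pose k' (z : R * R) : \bar R := (f z.2 * (normal_pdf 0 t (z.2 - z.1))%:E)%E.
  apply: (@measurable_fun_fubini_tonelli_F _ _ _ _ _ mu k').
  + apply: emeasurable_funM; first by apply: measurableT_comp.
    apply/measurable_EFinP; apply: (measurableT_comp (mpdf _ _)).
    exact: measurable_funB.
  + by move=> z; rewrite mule_ge0.
under eq_integral do rewrite inner.
rewrite (ge0_integral_normal _ _ mG); last first.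
  by move=> y; apply: integral_ge0 => w _; rewrite mule_ge0.
transitivity (\int[mu]_y \int[mu]_w k (y, w))%E.
  apply: eq_integral => y _; rewrite -ge0_integralZr//.
  - apply: emeasurable_funM => //; apply/measurable_EFinP.
    apply: measurableT_comp => //; exact: measurable_funB.
  - by move=> x _; rewrite mule_ge0.
rewrite (@fubini_tonelli _ _ _ _ _ mu mu k mk k0) (ge0_integral_normal _ _ mf f0).
apply: eq_integral => w _.
transitivity (\int[mu]_y ((f w * (normal_pdf 0 u w)%:E) *
    (normal_pdf (w * s ^+ 2 / u ^+ 2) (s * t / u) y)%:E))%E.
  apply: eq_integral => y _; rewrite /k/= -!muleA; congr (_ * _)%E.
  by rewrite -!EFinM -normal_pdf_conv// mulrC.
rewrite ge0_integralZl//.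
- by rewrite integral_normal_pdf mule1.
- by apply/measurable_EFinP; exact: mpdf.
- by rewrite mule_ge0.
Qed.

End normal_integral.

Section normal_moments.
Context (R : realType) (s : R).
Hypothesis s0 : 0 < s.
Local Notation nu := (normal_prob 0 s).

Lemma integrable_normal_sqr :
  nu.-integrable setT (fun y : R => (y ^+ 2)%:E).
Proof.
(* With [r ^+ 2 = 2^-1] the exponent is [u = y ^+ 2 / (4 * s ^+ 2)], so [u <= expR u] bounds
   [y ^+ 2] by [4 * s ^+ 2] times an integrable exponential. *)
pose r : R := Num.sqrt 2^-1.
have r0 : 0 < r by rewrite sqrtr_gt0 invr_gt0.
have r2 : 1 - r ^+ 2 = 2^-1 by rewrite sqr_sqrtr ?invr_ge0//; field.
have intE : nu.-integrable setT (fun y : R =>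
    (expR ((1 - r ^+ 2) * (y ^+ 2 / (2 * s ^+ 2))))%:E).
  apply/integrableP; split.
    by apply/measurable_EFinP; exact: measurable_expsq.
  under eq_integral do rewrite /= ger0_norm ?expR_ge0//.
  by rewrite integral_normal_expsq// ltry.
apply: (le_integrable measurableT _ _ (integrableZl measurableT (4 * s ^+ 2) intE)).
  by apply/measurable_EFinP; exact: measurable_funX.
move=> y _ /=; rewrite lee_fin r2 !ger0_norm ?sqr_ge0 ?mulr_ge0 ?expR_ge0 ?sqr_ge0 ?(ltW s0)//.
have := expR_ge1Dx (2^-1 * (y ^+ 2 / (2 * s ^+ 2))) => H.
have s2 : 0 < 4 * s ^+ 2 by rewrite mulr_gt0// exprn_gt0.
apply: (@le_trans _ _ (4 * s ^+ 2 * (2^-1 * (y ^+ 2 / (2 * s ^+ 2))))).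
  by rewrite le_eqVlt; apply/orP; left; apply/eqP; field; rewrite gt_eqF.
by rewrite ler_pM2l// (le_trans _ H)// lerDr.
Qed.

Lemma integrable_normal_id : nu.-integrable setT (EFin \o (@idfun R)).
Proof.
have int1 : nu.-integrable setT (EFin \o (fun _ : R => 1 : R)).
  exact: (bmf_integrable nu (bmf_cst R 1)).
apply: (le_integrable measurableT _ _ (integrableD measurableT int1 integrable_normal_sqr)).
  by apply/measurable_EFinP; exact: measurable_id.
move=> y _ /=; rewrite lee_fin [leRHS]ger0_norm ?addr_ge0 ?sqr_ge0//.
have := sqr_ge0 (`|y| - 1); rewrite sqrrB real_normK ?num_real// => H.
have := normr_ge0 y; lra.
Qed.

(* The Laplace transform and [1 + u <= expR u] give
   [h * m <= expR (h ^+ 2 * s ^+ 2 / 2) - 1] for every [h]; let [h] tend to [0]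
   from both sides. The second moment is obtained in the same way from
   [integral_normal_expsq], letting [r] tend to [1]. *)
Lemma normal_mean : \int[nu]_y y = 0.
Proof.
pose m := \int[nu]_y y.
have key (h : R) : 1 + h * m <= expR (h ^+ 2 * s ^+ 2 / 2).
  have E := integral_normal_explin h s0.
  have iE : nu.-integrable setT (EFin \o (fun y : R => expR (h * y))).
    apply/integrableP; split.
      by apply/measurable_EFinP; apply: measurableT_comp.
    under eq_integral do rewrite /= ger0_norm ?expR_ge0//.
    by rewrite E ltry.
  have i1 : nu.-integrable setT (EFin \o (fun _ : R => 1 : R)).
    exact: (bmf_integrable nu (bmf_cst R 1)).
  have ih : nu.-integrable setT (EFin \o (fun y : R => h * y)).
    exact: (integrableZl measurableT h integrable_normal_id).
  have -> : 1 + h * m = \int[nu]_y (1 + h * y).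
    rewrite RintegralD// RintegralZl//; last exact: integrable_normal_id.
    by rewrite (prob_Rintegral_cst nu).
  have -> : expR (h ^+ 2 * s ^+ 2 / 2) = \int[nu]_y expR (h * y).
    by rewrite /Rintegral E.
  apply: le_Rintegral => //.
    exact: (integrableD measurableT i1 ih).
  by move=> y _; exact: expR_ge1Dx.
have exp2 (x : R) : 0 < x -> x < 2^-1 -> expR x <= 1 + 2 * x.
  move=> x0 x1; have := expR_ge1Dx (- x); rewrite expRN => H.
  have e0 := expR_gt0 x.
  rewrite -[leLHS]invrK.
  apply: (@le_trans _ _ (1 - x)^-1).
    by rewrite lef_pV2 ?posrE ?invr_gt0//; lra.
  rewrite invf_ple ?posrE; [|lra..].
  rewrite -div1r ler_pdivrMr; nra.
(* [b] is one of the two signs. With [h = b * e / s] the exponent in [key] becomes [e ^+ 2 / 2], and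
   division by [e / s] leaves the error [e * s]. *)
have sgn (b : R) : b ^+ 2 = 1 -> b * m <= 0.
  move=> b1; apply: (@ler_eps _ _ _ s) => e /andP[e0 e1].
  have := key (b * e / s).
  have -> : (b * e / s) ^+ 2 * s ^+ 2 / 2 = e ^+ 2 / 2.
    by rewrite !exprMn b1 exprVn; field; rewrite gt_eqF.
  move=> H; have := exp2 (e ^+ 2 / 2); rewrite divr_gt0 ?exprn_gt0// => /(_ isT).
  have e2 : e ^+ 2 / 2 < 2^-1 by nra.
  move=> /(_ e2) => H2.
  have {H H2} H : b * e / s * m <= e ^+ 2 by lra.
  have : (e / s) * (b * m) <= (e / s) * (e * s).
    apply: le_trans (_ : e ^+ 2 <= _); first by apply: le_trans H; lra.
    by rewrite le_eqVlt; apply/orP; left; apply/eqP; field; rewrite gt_eqF.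
  by rewrite add0r ler_pM2l// divr_gt0.
apply/eqP; rewrite eq_le; apply/andP; split.
  by rewrite -[leLHS]mul1r; apply: sgn; rewrite expr1n.
by rewrite -oppr_le0 -mulN1r; apply: sgn; rewrite sqrrN expr1n.
Qed.

Lemma normal_second_moment : \int[nu]_y y ^+ 2 = s ^+ 2.
Proof.
pose q := \int[nu]_y y ^+ 2.
have q0 : 0 <= q by apply: Rintegral_ge0 => y _; exact: sqr_ge0.
pose m := q / (2 * s ^+ 2).
have s20 : 0 < 2 * s ^+ 2 by rewrite mulr_gt0// exprn_gt0.
have m0 : 0 <= m by rewrite divr_ge0// ltW.
have key (r : R) : 0 < r -> 1 + (1 - r ^+ 2) * m <= r^-1.
  move=> r0; set h := 1 - r ^+ 2.
  have E := integral_normal_expsq s0 r0.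
  have iE : nu.-integrable setT
      (EFin \o (fun y : R => expR (h * (y ^+ 2 / (2 * s ^+ 2))))).
    apply/integrableP; split.
      by apply/measurable_EFinP; exact: measurable_expsq.
    under eq_integral do rewrite /= ger0_norm ?expR_ge0//.
    by rewrite E ltry.
  have i1 : nu.-integrable setT (EFin \o (fun _ : R => 1 : R)).
    exact: (bmf_integrable nu (bmf_cst R 1)).
  have ih : nu.-integrable setT
      (EFin \o (fun y : R => h / (2 * s ^+ 2) * y ^+ 2)).
    exact: (integrableZl measurableT (h / (2 * s ^+ 2)) integrable_normal_sqr).
  have -> : 1 + h * m = \int[nu]_y (1 + h / (2 * s ^+ 2) * y ^+ 2).
    rewrite RintegralD// RintegralZl//; last exact: integrable_normal_sqr.
    by rewrite (prob_Rintegral_cst nu) /m mulrCA -/q [h / _ * _]mulrC.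
  have -> : r^-1 = \int[nu]_y expR (h * (y ^+ 2 / (2 * s ^+ 2))).
    by rewrite /Rintegral E.
  apply: le_Rintegral => //.
    exact: (integrableD measurableT i1 ih).
  move=> y _; rewrite (le_trans _ (expR_ge1Dx _))// lerD2l.
  by rewrite -mulrA [_^-1 * _]mulrC.
have k2 (r : R) : 0 < r -> (1 - r ^+ 2) * m * r <= 1 - r.
  move=> r0; have := key _ r0; rewrite -(ler_pM2r r0) mulVf ?gt_eqF// => H.
  by lra.
(* The factor [1 - r ^+ 2] changes sign at [r = 1], so [r = 1 - e] and [r = 1 + e] give opposite
   bounds after division by [e]. The constants 3 and 4 absorb the terms of higher order in the
   expanded products. *)
have ub : 2 * m <= 1.
  apply: (@ler_eps _ _ _ (3 * m)) => e /andP[e0 e1].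
  have := k2 (1 - e); rewrite subr_gt0 => /(_ e1) H.
  have {}H : e * ((2 - e) * (1 - e) * m) <= e * 1 by nra.
  rewrite ler_pM2l// in H; nra.
have lb : 1 <= 2 * m.
  apply: (@ler_eps _ _ _ (4 * m)) => e /andP[e0 e1].
  have := k2 (1 + e); rewrite addr_gt0// => /(_ isT) H.
  have {}H : e * 1 <= e * ((2 + e) * (1 + e) * m) by nra.
  rewrite ler_pM2l// in H; nra.
have m12 : 2 * m = 1 by apply/eqP; rewrite eq_le ub lb.
have : q = 2 * m * s ^+ 2 by rewrite /m; field; rewrite gt_eqF.
by rewrite m12 mul1r.
Qed.

(** What matters is the scaling [s ^+ 3]. With [z = |y| / s], nonnegativity of [(z * (z - 4)) ^+ 2]
    yields [z ^+ 3 <= 8 * (1 + z ^+ 2 / 8) ^+ 2], which is at most [8 * expR (z ^+ 2 / 4)]; this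
    exponential has integral sqrt 2, bounded by 2, whence 16. *)
Lemma normal_third_moment :
  nu.-integrable setT (EFin \o (fun y : R => `|y| ^+ 3)) /\
  \int[nu]_y `|y| ^+ 3 <= 16 * s ^+ 3.
Proof.
pose r : R := Num.sqrt 2^-1.
have r0 : 0 < r by rewrite sqrtr_gt0 invr_gt0.
have r2' : r ^+ 2 = 2^-1 by rewrite sqr_sqrtr ?invr_ge0.
have r2 : 1 - r ^+ 2 = 2^-1 by rewrite r2'; field.
pose g (y : R) := expR ((1 - r ^+ 2) * (y ^+ 2 / (2 * s ^+ 2))).
have E : (\int[nu]_y (g y)%:E = r^-1%:E)%E by exact: integral_normal_expsq.
have intE : nu.-integrable setT (EFin \o g).
  apply/integrableP; split.
    by apply/measurable_EFinP; exact: measurable_expsq.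
  under eq_integral do rewrite /= ger0_norm ?expR_ge0//.
  by rewrite E ltry.
have intE2 : nu.-integrable setT (EFin \o (fun y => 8 * s ^+ 3 * g y)).
  exact: (integrableZl measurableT (8 * s ^+ 3) intE).
have s3 : 0 < s ^+ 3 by rewrite exprn_gt0.
have le (y : R) : `|y| ^+ 3 <= 8 * s ^+ 3 * g y.
  pose z := `|y| / s.
  have z0 : 0 <= z by rewrite divr_ge0// ltW.
  have yz : `|y| = z * s by rewrite /z divfK// gt_eqF.
  have -> : g y = expR (z ^+ 2 / 8) ^+ 2.
    rewrite /g r2 -expRM_natl -mulr_natl; congr expR.
    rewrite -[y ^+ 2]real_normK ?num_real// yz.
    by field; rewrite gt_eqF.
  rewrite yz exprMn [leRHS]mulrAC (ler_pM2r s3).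
  have := expR_ge1Dx (z ^+ 2 / 8) => H.
  have H2 : (1 + z ^+ 2 / 8) ^+ 2 <= expR (z ^+ 2 / 8) ^+ 2.
    by rewrite ler_pXn2r ?nnegrE ?expR_ge0// addr_ge0// divr_ge0// sqr_ge0.
  apply: (le_trans _ (ler_wpM2l (ler0n _ 8) H2)).
  by have := sqr_ge0 (z * (z - 4)); lra.
have int3 : nu.-integrable setT (EFin \o (fun y : R => `|y| ^+ 3)).
  apply: (le_integrable measurableT _ _ intE2).
    apply/measurable_EFinP; apply: measurable_funX.
    exact: normr_measurable.
  move=> y _ /=; rewrite lee_fin [leLHS]ger0_norm ?exprn_ge0//.
  by rewrite (le_trans (le y))// ler_norm.
split => //.
have : \int[nu]_y `|y| ^+ 3 <= \int[nu]_y (8 * s ^+ 3 * g y).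
  by apply: le_Rintegral => // y _; exact: le.
rewrite RintegralZl// [X in _ * X](_ : _ = r^-1); last first.
  by rewrite /Rintegral E.
move=> /le_trans; apply.
have r12 : 2^-1 <= r by nra.
have : r^-1 <= 2 by rewrite -[leRHS]invrK lef_pV2 ?posrE ?invr_gt0.
nra.
Qed.

End normal_moments.

(** * Lindeberg replacement *)

Section taylor_class.
Context (R : realType).
Implicit Types (g : R -> R) (nu : probability (measurableTypeR R) R).

(** [g1] and [g2] are specified by the uniform expansion alone, not as derivatives, so the class
    passes through averages with the same [K] and without differentiation under the integral. *)
Definition taylor (K : R) (g g1 g2 : R -> R) :=
  [/\ bmf g, bmf g1, bmf g2 & forall x h,
    `|g (x + h) - g x - g1 x * h - g2 x * (h ^+ 2 / 2)| <= K * `|h| ^+ 3].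

(** The transition operator of adding an independent variable of law [nu]. Its iterates stand for a
    sum of independent variables, none of which has to be constructed. *)
Definition avg nu g x := \int[nu]_y g (x + y).

Lemma bmf_addl g x : bmf g -> bmf (fun y : R => g (x + y)).
Proof. by move=> bg; apply: (bmf_comp bg); exact: measurable_funD. Qed.

Lemma bmf_avg nu g : bmf g -> bmf (avg nu g).
Proof.
move=> bg; have bf : bmf (fun z : R * measurableTypeR R => g (z.1 + z.2)).
  by apply: (bmf_comp bg); exact: measurable_funD.
exact: (bmf_Rintegralr nu bf).
Qed.

Lemma taylor_avg nu K g g1 g2 : taylor K g g1 g2 ->
  taylor K (avg nu g) (avg nu g1) (avg nu g2).
Proof.
move=> [bg bg1 bg2 H]; split; [exact: bmf_avg..|move=> x h].
have bx (f : R -> R) z : bmf f -> bmf (fun y : measurableTypeR R => f (z + y)).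
  exact: bmf_addl.
rewrite /avg -!bmf_RintegralZr -?bmf_RintegralB; do ?apply: bmfB;
  do ?apply: bmfM; try exact: bmf_cst; try exact: bx.
apply: bmf_Rintegral_bound.
  by do ?apply: bmfB; do ?apply: bmfM; try exact: bmf_cst; exact: bx.
by move=> y; rewrite (addrAC x h); exact: H.
Qed.

Definition moments3 nu (v C : R) :=
  [/\ nu.-integrable setT (EFin \o (fun y : R => y)),
      nu.-integrable setT (EFin \o (fun y : R => y ^+ 2)),
      nu.-integrable setT (EFin \o (fun y : R => `|y| ^+ 3)),
      \int[nu]_y y = 0 & \int[nu]_y y ^+ 2 = v /\ \int[nu]_y `|y| ^+ 3 <= C].

Lemma avg_taylor_moments nu v C K g g1 g2 x : 0 <= K -> taylor K g g1 g2 ->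
  moments3 nu v C -> `|avg nu g x - g x - g2 x * (v / 2)| <= K * C.
Proof.
move=> K0 [bg bg1 bg2 H] [i1 i2 i3 e1 [e2 e3]].
have ig : nu.-integrable setT (EFin \o (fun y : R => g (x + y))).
  exact: (bmf_integrable nu (bmf_addl x bg)).
have ic (c : R) : nu.-integrable setT (EFin \o (fun _ : R => c)).
  exact: (bmf_integrable nu (bmf_cst (measurableTypeR R) c)).
have igc : nu.-integrable setT (EFin \o (fun y : R => g (x + y) - g x)).
  exact: (integrableB measurableT ig (ic _)).
have ig1 : nu.-integrable setT (EFin \o (fun y : R => g1 x * y)).
  exact: (integrableZl measurableT (g1 x) i1).
have i2' : nu.-integrable setT (EFin \o (fun y : R => 2^-1 * y ^+ 2)).
  exact: (integrableZl measurableT 2^-1 i2).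
have ig2 : nu.-integrable setT (EFin \o (fun y : R => g2 x * (2^-1 * y ^+ 2))).
  exact: (integrableZl measurableT (g2 x) i2').
have igcc : nu.-integrable setT (EFin \o (fun y : R => g (x + y) - g x - g1 x * y)).
  exact: (integrableB measurableT igc ig1).
have -> : avg nu g x - g x - g2 x * (v / 2) =
    \int[nu]_y (g (x + y) - g x - g1 x * y - g2 x * (2^-1 * y ^+ 2)).
  rewrite RintegralB// RintegralB// RintegralB// !RintegralZl// e1 e2.
  by rewrite prob_Rintegral_cst mulr0 subr0 (mulrC 2^-1).
apply: (@le_trans _ _ (\int[nu]_y (K * `|y| ^+ 3))).
  apply: le_trans (le_normr_Rintegral measurableT _) _.
    exact: (integrableB measurableT igcc ig2).
  apply: le_Rintegral => //.
  - exact: (integrable_norm (integrableB measurableT igcc ig2)).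
  - exact: (integrableZl measurableT K i3).
  - by move=> y _; have := H x y; rewrite (mulrC 2^-1).
by rewrite RintegralZl// ler_wpM2l.
Qed.

End taylor_class.

Section lindeberg.
Context d (T : measurableType d) (R : realType) (P : probability T R).
Context (nu : probability (measurableTypeR R) R) (v C M : R).
Hypothesis hnu : moments3 nu v C.

(** Adding [xi] to [S] and adding an independent variable of law [nu] give the same expansion up to
    second order, because the first two moments match. Only the two third-order remainders are left,
    of sizes [K * M ^+ 3] and [K * C]. *)
Lemma lindeberg_step (S xi : T -> R) K g g1 g2 : 0 <= K -> taylor K g g1 g2 ->
  measurable_fun setT S -> measurable_fun setT xi -> (forall w, `|xi w| <= M) ->
  (forall phi : R -> R, bmf phi -> \int[P]_w (phi (S w) * xi w) = 0) ->
  (forall phi : R -> R, bmf phi ->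
     \int[P]_w (phi (S w) * xi w ^+ 2) = v * \int[P]_w phi (S w)) ->
  `|\int[P]_w g (S w + xi w) - \int[P]_w avg nu g (S w)| <= K * (C + M ^+ 3).
Proof.
move=> K0 tg mS mxi xiM e1 e2.
have [bg bg1 bg2 H] := tg.
have bS (f : R -> R) : bmf f -> bmf (fun w => f (S w)) by move=> bf; exact: bmf_comp.
have bxi : bmf xi by split => //; exists M.
have bgx : bmf (fun w => g (S w + xi w)).
  by apply: (bmf_comp bg); exact: measurable_funD.
have ba : bmf (fun w => avg nu g (S w)) by apply: bS; exact: bmf_avg.
have bx1 : bmf (fun w => g1 (S w) * xi w) by apply: bmfM => //; exact: bS.
have bx2 : bmf (fun w => 2^-1 * (g2 (S w) * xi w ^+ 2)).
  by apply: bmfM => //; apply: bmfM; [exact: bS|exact: bmfX].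
have b2 : bmf (fun w => v / 2 * g2 (S w)) by apply: bmfM => //; exact: bS.
have bgS := bS _ bg.
have E1 : `|\int[P]_w g (S w + xi w) - \int[P]_w g (S w)
    - v / 2 * \int[P]_w g2 (S w)| <= K * M ^+ 3.
  have -> : \int[P]_w g (S w + xi w) - \int[P]_w g (S w)
      - v / 2 * \int[P]_w g2 (S w) =
    \int[P]_w (g (S w + xi w) - g (S w) - g1 (S w) * xi w
      - 2^-1 * (g2 (S w) * xi w ^+ 2)).
    rewrite (bmf_RintegralB _ _ bx2); last by do ?apply: bmfB.
    rewrite (bmf_RintegralB _ _ bx1); last by do ?apply: bmfB.
    rewrite bmf_RintegralB// bmf_RintegralZl; last first.
      by apply: bmfM; [exact: bS|exact: bmfX].
    by rewrite (e1 _ bg1) (e2 _ bg2) subr0 mulrA (mulrC v).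
  apply: bmf_Rintegral_bound; first by do ?apply: bmfB.
  move=> w; have -> : 2^-1 * (g2 (S w) * xi w ^+ 2) = g2 (S w) * (xi w ^+ 2 / 2).
    by ring.
  apply: le_trans (H (S w) (xi w)) _.
  by rewrite ler_wpM2l// lerXn2r ?nnegrE// (le_trans _ (xiM w)).
have E2 : `|\int[P]_w avg nu g (S w) - \int[P]_w g (S w)
    - v / 2 * \int[P]_w g2 (S w)| <= K * C.
  rewrite -bmf_RintegralB// -bmf_RintegralZl; last exact: bS.
  rewrite -bmf_RintegralB//; last by do ?apply: bmfB.
  apply: bmf_Rintegral_bound; first by do ?apply: bmfB.
  by move=> w; rewrite (mulrC (v / 2)); exact: (avg_taylor_moments (S w) K0 tg hnu).
rewrite mulrDr; set a := \int[P]_w g _ in E1 *; set b := \int[P]_w avg _ _ _ in E2 *.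
set c := \int[P]_w g _ in E1 E2; set e := v / 2 * _ in E1 E2.
have -> : a - b = (a - c - e) - (b - c - e) by ring.
by rewrite (le_trans (ler_normB _ _))// addrC lerD.
Qed.

(** The last summand is replaced first: this turns [g] into [avg nu g], which has a Taylor expansion
    with the same [K], so the induction hypothesis applies to the shorter sum. *)
Lemma lindeberg (xi : nat -> T -> R) N K g g1 g2 : 0 <= K -> taylor K g g1 g2 ->
  (forall j, measurable_fun setT (xi j)) -> (forall j w, `|xi j w| <= M) ->
  (forall n (phi : R -> R), bmf phi ->
     \int[P]_w (phi (\sum_(j < n) xi j w) * xi n w) = 0) ->
  (forall n (phi : R -> R), bmf phi ->
     \int[P]_w (phi (\sum_(j < n) xi j w) * xi n w ^+ 2) =
     v * \int[P]_w phi (\sum_(j < n) xi j w)) ->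
  `|\int[P]_w g (\sum_(j < N) xi j w) - iter N (avg nu) g 0|
     <= N%:R * (K * (C + M ^+ 3)).
Proof.
move=> K0 + mxi xiM e1 e2.
elim: N g g1 g2 => [|N ih] g g1 g2 tg.
  rewrite mul0r; under eq_Rintegral do rewrite big_ord0.
  by rewrite prob_Rintegral_cst/= subrr normr0.
rewrite iterSr; have := ih _ _ _ (taylor_avg nu tg).
have mS : measurable_fun setT (fun w => \sum_(j < N) xi j w).
  by apply: measurable_sum => j.
have := lindeberg_step K0 tg mS (mxi N) (xiM N) (e1 N) (e2 N).
under [in X in X -> _]eq_Rintegral do rewrite -(big_ord_recr _ (fun j => xi j _)).
set a := \int[P]_w _; set b := \int[P]_w _; set c := iter _ _ _ _ => H1 H2.
have -> : a - c = (a - b) + (b - c) by ring.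
by rewrite (le_trans (ler_normD _ _))// -natr1 mulrDl mul1r addrC lerD.
Qed.

End lindeberg.

Section gaussian_semigroup.
Context (R : realType).
Implicit Types (g : R -> R) (w : R).

Lemma moments3_centered_gaussian w : 0 <= w ->
  moments3 (centered_gaussian w) w (16 * Num.sqrt w ^+ 3).
Proof.
rewrite le_eqVlt => /predU1P[<-|w0].
  rewrite /centered_gaussian eqxx.
  have idir (f : R -> R) : measurable_fun setT f ->
      (\d_(0 : measurableTypeR R) : probability _ R).-integrable setT (EFin \o f).
    move=> mf; apply/integrableP; split; first exact/measurable_EFinP.
    rewrite integral_dirac//; last by do 2 apply: measurableT_comp => //.
    by rewrite diracT mul1e ltry.
  have rdir (f : R -> R) : measurable_fun setT f ->
      \int[\d_(0 : measurableTypeR R)]_y f y = f 0.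
    move=> mf; rewrite /Rintegral integral_dirac//; last exact/measurable_EFinP.
    by rewrite diracT mul1e.
  have m3 : measurable_fun setT (fun y : R => `|y| ^+ 3).
    by apply: measurable_funX; exact: normr_measurable.
  split; [exact: idir..|exact: rdir|split].
    by rewrite rdir// expr0n.
  by rewrite rdir// normr0 expr0n/= sqrtr0 expr0n mulr0.
rewrite /centered_gaussian gt_eqF//.
have s0 : 0 < Num.sqrt w by rewrite sqrtr_gt0.
have [i3 e3] := normal_third_moment s0.
split => //.
- exact: integrable_normal_id.
- exact: integrable_normal_sqr.
- exact: normal_mean.
- by rewrite normal_second_moment// sqr_sqrtr// ltW.
Qed.

Lemma bmf_convolution (nu1 nu2 nu3 : probability (measurableTypeR R) R) g :
  (forall f : R -> \bar R, measurable_fun setT f -> (forall x, 0 <= f x)%E ->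
    (\int[nu1]_y \int[nu2]_z f (y + z)%R = \int[nu3]_w f w)%E) ->
  bmf g ->
  \int[nu1]_y \int[nu2]_z g (y + z) = \int[nu3]_w g w.
Proof.
move=> H bg.
have [M M0 gM] := bmf_bound bg.
(* The hypothesis concerns nonnegative functions; adding the bound [M] reaches that case, and the
   constant comes out of every integral unchanged. *)
pose f x := g x + M.
have f0 x : 0 <= f x.
  by rewrite /f -lerBlDr sub0r; have := gM x; rewrite ler_norml => /andP[].
have bf : bmf f by apply: bmfD.
have E (nu : probability (measurableTypeR R) R) (h : R -> R) :
    bmf h -> \int[nu]_y h y = \int[nu]_y (h y + M) - M.
  move=> bh; rewrite bmf_RintegralD ?prob_Rintegral_cst ?addrK//.
have bz (y : R) : bmf (fun z : R => g (y + z)) by exact: bmf_addl.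
have bfz (y : R) : bmf (fun z : R => f (y + z)) by exact: bmf_addl.
have bin : bmf (fun y : R => \int[nu2]_z f (y + z)) by exact: (bmf_avg nu2 bf).
rewrite (E nu3 _ bg).
under eq_Rintegral do rewrite (E nu2 _ (bz _)).
rewrite (bmf_RintegralB nu1 bin (bmf_cst _ M)) prob_Rintegral_cst.
congr (_ - _); rewrite /Rintegral; congr fine.
rewrite -(H (EFin \o f)); last 2 first.
- by apply/measurable_EFinP; case: bf.
- by move=> x; rewrite lee_fin.
by apply: eq_integral => y _; rewrite -(bmf_integral nu2 (bfz y)).
Qed.

Lemma iter_avg_normal (s : R) N g : 0 < s -> bmf g ->
  iter N.+1 (avg (normal_prob 0 s)) g =
  avg (normal_prob 0 (Num.sqrt N.+1%:R * s)) g.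
Proof.
move=> s0 bg; elim: N => [|N ih].
  by rewrite sqrtr1 mul1r.
rewrite iterS ih; apply/funext => x; rewrite /avg.
under eq_Rintegral do under eq_Rintegral do rewrite -addrA.
apply: (bmf_convolution _ (bmf_addl x bg)) => f mf f0.
apply: (normal_convolution s0 _ _ _ mf f0).
- by rewrite mulr_gt0// sqrtr_gt0.
- by rewrite mulr_gt0// sqrtr_gt0.
- have sq n : Num.sqrt n%:R ^+ 2 = n%:R :> R by rewrite sqr_sqrtr.
  by rewrite !exprMn !sq -(natr1 N.+1) mulrDl mul1r addrC.
Qed.

(** The fully replaced normalized sum already has the limit law for each [N], so no limit has to be
    taken on the Gaussian side. *)
Lemma iter_avg_centered_gaussian w N g : 0 <= w -> bmf g ->
  iter N.+1 (avg (centered_gaussian (w / N.+1%:R))) g =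
  avg (centered_gaussian w) g.
Proof.
rewrite le_eqVlt => /predU1P[<-|w0] bg.
  rewrite mul0r; have E (f : R -> R) : bmf f -> avg (centered_gaussian 0) f = f.
    move=> [mf _]; apply/funext => x.
    rewrite /avg /centered_gaussian eqxx /Rintegral integral_dirac//.
      by rewrite diracT mul1e/= addr0.
    by apply/measurable_EFinP; apply: measurableT_comp => //; exact: measurable_funD.
  rewrite (E _ bg); elim: N => [|N ih]; first by rewrite /= E.
  by rewrite iterS ih E.
have wN0 : 0 < w / N.+1%:R by rewrite divr_gt0.
rewrite /centered_gaussian (gt_eqF w0) (gt_eqF wN0).
have s0 : 0 < Num.sqrt (w / N.+1%:R) by rewrite sqrtr_gt0.
have -> : Num.sqrt w = Num.sqrt N.+1%:R * Num.sqrt (w / N.+1%:R).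
  by rewrite -sqrtrM ?ler0n// mulrC divfK// pnatr_eq0.
exact: iter_avg_normal.
Qed.

End gaussian_semigroup.

(** Scaling by [r^-1] divides each third-order error by [r ^+ 3], and there are [r ^+ 2]
    replacements: this is the rate [1 / r]. *)
Lemma clt_taylor d (T : measurableType d) (R : realType) (P : probability T R)
  (v M : R) (xi : nat -> T -> R) N K g g1 g2 :
  0 <= v -> 0 <= M -> 0 <= K -> taylor K g g1 g2 ->
  (forall j, measurable_fun setT (xi j)) -> (forall j w, `|xi j w| <= M) ->
  (forall n (phi : R -> R), bmf phi ->
     \int[P]_w (phi (\sum_(j < n) xi j w) * xi n w) = 0) ->
  (forall n (phi : R -> R), bmf phi ->
     \int[P]_w (phi (\sum_(j < n) xi j w) * xi n w ^+ 2) =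
     v * \int[P]_w phi (\sum_(j < n) xi j w)) ->
  `|\int[P]_w g ((Num.sqrt N.+1%:R)^-1 * \sum_(j < N.+1) xi j w)
    - \int[centered_gaussian v]_x g x|
  <= K * (16 * Num.sqrt v ^+ 3 + M ^+ 3) / Num.sqrt N.+1%:R.
Proof.
move=> v0 M0 K0 tg mxi xiM e1 e2.
set r := Num.sqrt N.+1%:R.
have r0 : 0 < r by rewrite sqrtr_gt0.
have r2 : r ^+ 2 = N.+1%:R by rewrite sqr_sqrtr.
pose eta j w := r^-1 * xi j w.
have sumE n w : \sum_(j < n) eta j w = r^-1 * \sum_(j < n) xi j w.
  by rewrite mulr_sumr.
have brs (phi : R -> R) : bmf phi -> bmf (fun x => phi (r^-1 * x)).
  by move=> bphi; apply: (bmf_comp bphi); exact: measurable_funM.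
have bsum (phi : R -> R) n : bmf phi -> bmf (fun w => phi (\sum_(j < n) xi j w)).
  by move=> bphi; apply: (bmf_comp bphi); apply: measurable_sum => j.
have bxi j : bmf (xi j) by split => //; exists M.
have hnu := moments3_centered_gaussian (divr_ge0 v0 (ler0n _ N.+1)).
have := @lindeberg _ _ _ P _ _ _ (r^-1 * M) hnu eta N.+1 K g g1 g2 K0 tg.
have meta j : measurable_fun setT (eta j) by exact: measurable_funM.
have etaM j w : `|eta j w| <= r^-1 * M.
  by rewrite normrM gtr0_norm ?invr_gt0// ler_pM2l ?invr_gt0.
have e1' n (phi : R -> R) : bmf phi ->
    \int[P]_w (phi (\sum_(j < n) eta j w) * eta n w) = 0.
  move=> bphi.
  have E : \int[P]_w (phi (\sum_(j < n) eta j w) * xi n w) = 0.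
    by under eq_Rintegral do rewrite sumE; exact: e1 (brs _ bphi).
  transitivity (r^-1 * \int[P]_w (phi (\sum_(j < n) eta j w) * xi n w)).
    rewrite -bmf_RintegralZl; first by apply: eq_Rintegral => w _; rewrite mulrCA.
    apply: bmfM => //; under [X in bmf X]eq_fun do rewrite sumE.
    exact: (bsum _ n (brs _ bphi)).
  by rewrite E mulr0.
have e2' n (phi : R -> R) : bmf phi ->
    \int[P]_w (phi (\sum_(j < n) eta j w) * eta n w ^+ 2) =
    v / N.+1%:R * \int[P]_w phi (\sum_(j < n) eta j w).
  move=> bphi.
  have E : \int[P]_w (phi (\sum_(j < n) eta j w) * xi n w ^+ 2) =
      v * \int[P]_w phi (\sum_(j < n) eta j w).
    under eq_Rintegral do rewrite sumE.
    by under [in RHS]eq_Rintegral do rewrite sumE; exact: e2 (brs _ bphi).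
  transitivity (r ^- 2 * \int[P]_w (phi (\sum_(j < n) eta j w) * xi n w ^+ 2)).
    rewrite -bmf_RintegralZl.
      by apply: eq_Rintegral => w _; rewrite /eta exprMn exprVn mulrCA.
    apply: bmfM; last exact: bmfX.
    under [X in bmf X]eq_fun do rewrite sumE.
    exact: (bsum _ n (brs _ bphi)).
  by rewrite E r2 mulrCA mulrA.
move=> /(_ meta etaM e1' e2').
under eq_Rintegral do rewrite sumE.
have [bg _ _ _] := tg.
rewrite iter_avg_centered_gaussian// /avg.
rewrite (_ : \int[centered_gaussian v]_y g (0 + y) =
             \int[centered_gaussian v]_x g x); last first.
  by apply: eq_Rintegral => y _; rewrite add0r.
move=> /le_trans; apply.
have -> : Num.sqrt (v / N.+1%:R) = Num.sqrt v / r.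
  by rewrite sqrtrM// sqrtrV.
rewrite -r2 le_eqVlt; apply/orP; left; apply/eqP.
by field; rewrite gt_eqF.
Qed.

(** * Smooth approximation of Lipschitz functions *)

Section antiderivative.
Context (R : realType) (g : R -> R).
Hypothesis cg : continuous g.
Local Notation mu := (@lebesgue_measure R).

Lemma continuous_itv_integrable (a b : R) : mu.-integrable `[a, b] (EFin \o g).
Proof.
apply: continuous_compact_integrable; first exact: segment_compact.
exact: continuous_subspaceT.
Qed.

(* Both integrals start left of [0] and [x], so that the difference is the signed
   integral from [0] to [x]. *)
Definition primitive (x : R) : R :=
  \int[mu]_(t in `[Num.min 0 x - 1, x]) g t -
  \int[mu]_(t in `[Num.min 0 x - 1, 0]) g t.

(** Moving the base point further left adds the same integral to both terms. Differentiation at [x]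
    needs one base point that serves all nearby points. *)
Lemma primitiveE (b x : R) : b <= Num.min 0 x - 1 ->
  primitive x = \int[mu]_(t in `[b, x]) g t - \int[mu]_(t in `[b, 0]) g t.
Proof.
set a := Num.min 0 x - 1 => ba; rewrite /primitive -/a.
have m0 : Num.min 0 x <= 0 by rewrite ge_min lexx.
have mx : Num.min 0 x <= x by rewrite ge_min lexx orbT.
have a0 : a <= 0 by rewrite /a; lra.
have ax : a <= x by rewrite /a; lra.
have split (y : R) : a <= y -> \int[mu]_(t in `[b, y]) g t =
    \int[mu]_(t in `[b, a]) g t + \int[mu]_(t in `[a, y]) g t.
  move=> ay; have := @Rintegral_itvB R g (BLeft b) (BRight y) a
    (continuous_itv_integrable b y).
  rewrite !bnd_simp => /(_ ba ay).
  rewrite Rintegral_itv_obnd_cbnd => [<-|]; first by rewrite subrKC.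
  apply: integrableS (continuous_itv_integrable a y) => //.
  by apply: subset_itvr; rewrite bnd_simp.
by rewrite (split x ax) (split 0 a0) opprD addrACA subrr add0r.
Qed.

Lemma is_derive_primitive (x : R) : is_derive x 1 primitive (g x).
Proof.
have mx : Num.min 0 x <= x by rewrite ge_min lexx orbT.
have m0 : Num.min 0 x <= 0 by rewrite ge_min lexx.
(* One unit further left than the base point of [primitive x], so that [primitiveE] applies with
   this [b] at every [y] with [x - 1 < y]. *)
set b := Num.min 0 x - 2.
have bx : b < x by rewrite /b; lra.
have xu : x < x + 1 by rewrite ltrDl.
have [dF F'] := continuous_FTC1_closed xu (continuous_itv_integrable b (x + 1)) bx (@cg x).
pose F (y : R) : R := \int[mu]_(t in `[b, y]) g t.
have hF : is_derive x 1 F (g x).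
  by apply: DeriveDef; [exact: dF|rewrite -F' derive1E].
pose c : R := \int[mu]_(t in `[b, 0]) g t.
have hF2 : is_derive x 1 (F - cst c) (g x).
  by rewrite -[g x]subr0; apply: is_deriveB.
apply: near_eq_is_derive hF2; near=> y.
rewrite [RHS](@primitiveE b)//.
have xy : x - 1 < y by near: y; apply: lt_nbhsr; rewrite ltrBlDr ltrDl.
suff : Num.min 0 x - 1 <= Num.min 0 y by rewrite /b; lra.
by rewrite le_min; apply/andP; split; lra.
Unshelve. all: by end_near. Qed.

End antiderivative.

Lemma lipschitz_continuous_real (R : realType) (g : R -> R) (L : R) : 0 <= L ->
  (forall x y, `|g x - g y| <= L * `|x - y|) -> continuous g.
Proof.
move=> L0 gL x; apply/cvgrPdist_le => /= eps eps0; near=> y.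
rewrite (le_trans (gL _ _))//.
apply: (@le_trans _ _ ((L + 1) * `|x - y|)).
  by rewrite ler_wpM2r// lerDl.
rewrite mulrC -ler_pdivlMr ?ltr_wpDl//.
by near: y; apply: cvgr_dist_le => //; rewrite divr_gt0// ltr_wpDl.
Unshelve. all: by end_near. Qed.

Section differences.
Context (R : realType).
Implicit Types (u g : R -> R) (x h d : R).

Lemma is_derive_translate u d x l : is_derive (x + d) 1 u l ->
  is_derive x 1 (fun y => u (y + d)) l.
Proof.
have E : (fun h : R => h^-1 *: (((fun y => u (y + d)) \o shift x) (h *: 1)
      - u (x + d))) =
    (fun h => h^-1 *: ((u \o shift (x + d)) (h *: 1) - u (x + d))).
  by apply/funext => h /=; rewrite addrA.
by case=> ex dv; split; rewrite /derivable /derive E.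
Qed.

Lemma derive_continuous u u1 : (forall x, is_derive x 1 u (u1 x)) -> continuous u.
Proof.
move=> du x; apply/differentiable_continuous/derivable1_diffP.
by have [] := du x.
Qed.

Lemma derive_mvt u u1 x y : (forall x, is_derive x 1 u (u1 x)) ->
  exists c, Num.min x y <= c <= Num.max x y /\ u y - u x = u1 c * (y - x).
Proof.
move=> du; have cu := derive_continuous du.
wlog xy : x y / x <= y => [H|].
  have /orP[/H//|/H [c [cxy E]]] := le_total x y.
  exists c; rewrite minC maxC; split => //.
  by rewrite -(opprB (u x)) E -mulrN opprB.
have [c] := MVT_segment xy (fun z _ => du z) (continuous_subspaceT cu).
by rewrite in_itv/= => cxy E; exists c; rewrite min_l// max_r.
Qed.

Definition diffq d u x := (u (x + d) - u x) / d.

Lemma is_derive_diffq d u u1 : (forall x, is_derive x 1 u (u1 x)) ->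
  forall x, is_derive x 1 (diffq d u) (diffq d u1 x).
Proof.
move=> du x.
have -> : diffq d u = d^-1 \*: ((fun y => u (y + d)) - u).
  by apply/funext => y; rewrite /diffq/= mulrC.
have -> : diffq d u1 x = d^-1 *: (u1 (x + d) - u1 x).
  by rewrite /diffq mulrC.
exact: is_deriveZ (is_deriveB (is_derive_translate (du _)) (du x)).
Qed.

Lemma diffq_mvt d u u1 x : 0 < d -> (forall x, is_derive x 1 u (u1 x)) ->
  exists2 c, x <= c <= x + d & diffq d u x = u1 c.
Proof.
move=> d0 du; have [c []] := derive_mvt x (x + d) du.
have xd : x <= x + d by rewrite lerDl ltW.
rewrite min_l// max_r// => cxd E; exists c => //.
by rewrite /diffq E [x + d]addrC addrK mulfK// gt_eqF.
Qed.

Lemma diffq_bound d g B : 0 < d -> (forall x, `|g x| <= B) ->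
  forall x, `|diffq d g x| <= 2 * B / d.
Proof.
move=> d0 gB x; rewrite /diffq normrM normfV (gtr0_norm d0).
rewrite ler_pM2r ?invr_gt0// (le_trans (ler_normB _ _))//.
by have := gB x; have := gB (x + d); lra.
Qed.

(** The mean value point lies between 0 and [x], so its norm is at most that of [x]. Three uses give
    the cubic Taylor remainder, with constant [K] in place of the sharper [K / 6]. *)
Lemma derive_power_bound u u1 K n : (forall x, is_derive x 1 u (u1 x)) ->
  u 0 = 0 -> (forall x, `|u1 x| <= K * `|x| ^+ n) ->
  forall x, `|u x| <= K * `|x| ^+ n.+1.
Proof.
move=> du u0 H x; have [c [/andP[c1 c2]]] := derive_mvt 0 x du.
rewrite u0 !subr0 => ->; rewrite normrM exprSr mulrA ler_wpM2r//.
have K0 : 0 <= K.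
  by have := le_trans (normr_ge0 _) (H 1); rewrite normr1 expr1n mulr1.
rewrite (le_trans (H c))// ler_wpM2l// lerXn2r ?nnegrE//.
have [x0|x0] := leP 0 x.
  move: c1 c2; rewrite min_l// max_r// => c1 c2.
  by rewrite !ger0_norm.
move: c1 c2; rewrite min_r ?max_l ?(ltW x0)// => c1 c2.
by rewrite !ler0_norm ?(ltW x0)// lerN2.
Qed.

Lemma taylor_of_derive (f f1 f2 f3 : R -> R) (B0 B1 B2 K : R) :
  (forall x, is_derive x 1 f (f1 x)) -> (forall x, is_derive x 1 f1 (f2 x)) ->
  (forall x, is_derive x 1 f2 (f3 x)) ->
  (forall x, `|f x| <= B0) -> (forall x, `|f1 x| <= B1) ->
  (forall x, `|f2 x| <= B2) -> (forall x, `|f3 x| <= K) -> taylor K f f1 f2.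
Proof.
move=> d0 d1 d2 b0 b1 b2 b3.
have bmf_der (u u1 : R -> R) (B : R) : (forall x, is_derive x 1 u (u1 x)) ->
    (forall x, `|u x| <= B) -> bmf u.
  move=> du uB; split; last by exists B.
  exact: continuous_measurable_fun (derive_continuous du).
split; [exact: bmf_der d0 b0|exact: bmf_der d1 b1|exact: bmf_der d2 b2|].
move=> x h.
have tr (u u1 : R -> R) : (forall x, is_derive x 1 u (u1 x)) ->
    forall y : R, is_derive y 1 (fun t => u (t + x)) (u1 (y + x)).
  by move=> du y; apply: is_derive_translate; exact: du.
(* [r2], [r1], [r0] are the remainders at [x] of the expansions of [f2], [f1], [f]. Each vanishes at
   0 and is the derivative of the next. *)
pose r2 := (fun t => f2 (t + x)) - cst (f2 x).
have dr2 (y : R) : is_derive y 1 r2 (f3 (y + x)).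
  by rewrite -[f3 _]subr0; apply: is_deriveB; exact: tr.
have r2E t : r2 t = f2 (t + x) - f2 x by [].
have H2 : forall t, `|r2 t| <= K * `|t| ^+ 1.
  apply: (derive_power_bound dr2); first by rewrite r2E add0r subrr.
  by move=> y; rewrite expr0 mulr1.
pose r1 := (fun t => f1 (t + x)) - (cst (f1 x) + f2 x \*: id).
have r1E t : r1 t = f1 (t + x) - (f1 x + f2 x * t) by [].
have dr1 (y : R) : is_derive y 1 r1 (r2 y).
  have -> : r2 y = f2 (y + x) - (0 + f2 x *: 1) by rewrite r2E add0r [_ *: 1]mulr1.
  exact: is_deriveB (tr _ _ d1 y) (is_deriveD (is_derive_cst _ _ _)
    (is_deriveZ _ (is_derive_id _ _))).
have H1 : forall t, `|r1 t| <= K * `|t| ^+ 2.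
  apply: (derive_power_bound dr1) => //.
  by rewrite r1E add0r mulr0 addr0 subrr.
pose r0 := (fun t => f (t + x)) - (cst (f x) + f1 x \*: id
  + (f2 x / 2) \*: (id * id)).
have r0E t : r0 t = f (t + x) - (f x + f1 x * t + f2 x / 2 * (t * t)) by [].
have dr0 (y : R) : is_derive y 1 r0 (r1 y).
  have -> : r1 y = f1 (y + x) -
      (0 + f1 x *: 1 + (f2 x / 2) *: (y *: 1 + y *: 1)).
    by rewrite r1E add0r -![_ *: _]/(_ * _); congr (_ - _); field.
  exact: is_deriveB (tr _ _ d0 y) (is_deriveD (is_deriveD (is_derive_cst _ _ _)
    (is_deriveZ _ (is_derive_id _ _)))
    (is_deriveZ _ (is_deriveM (is_derive_id _ _) (is_derive_id _ _)))).
have H0 : forall t, `|r0 t| <= K * `|t| ^+ 3.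
  apply: (derive_power_bound dr0) => //.
  by rewrite r0E add0r !mulr0 !addr0 subrr.
have := H0 h; rewrite r0E [h + x]addrC; congr (`|_| <= _).
by field.
Qed.

(* Apply the difference quotient three times to a threefold antiderivative of [g]:
   the result is an average of [g] over [[x, x + 3 d]] and its third derivative is
   the third difference quotient of [g], which is bounded. *)
Lemma taylor_approximation g (B L e : R) : 0 < e -> 0 <= L ->
  (forall x, `|g x| <= B) -> (forall x y, `|g x - g y| <= L * `|x - y|) ->
  exists K f f1 f2, [/\ 0 <= K, taylor K f f1 f2 & forall x, `|f x - g x| <= e].
Proof.
move=> e0 L0 gB gL.
have cg := lipschitz_continuous_real L0 gL.
have cont (u u1 : R -> R) := @derive_continuous u u1.
pose G1 := primitive g.
have d1 : forall x, is_derive x 1 G1 (g x) by exact: is_derive_primitive.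
pose G2 := primitive G1.
have d2 : forall x, is_derive x 1 G2 (G1 x).
  by apply: is_derive_primitive; exact: cont d1.
pose G3 := primitive G2.
have d3 : forall x, is_derive x 1 G3 (G2 x).
  by apply: is_derive_primitive; exact: cont d2.
(* [f x] will be a value of [g] on [[x, x + 3 d]], hence within [L * 3 d] of [g x]; [L + 1] allows
   [L = 0]. *)
pose d := e / (3 * (L + 1)).
have L1 : 0 < L + 1 by rewrite ltr_wpDl.
have d0 : 0 < d by rewrite divr_gt0// mulr_gt0.
pose D := diffq d.
have DE := @is_derive_diffq d.
have D3 (u1 u2 u3 u4 : R -> R) (h1 : forall x, is_derive x 1 u1 (u2 x))
   (h2 : forall x, is_derive x 1 u2 (u3 x)) (h3 : forall x, is_derive x 1 u3 (u4 x)) :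
  forall x, exists2 c, x <= c <= x + 3 * d & D (D (D u1)) x = u4 c.
  move=> x; rewrite /D.
  have [c1 /andP[xc1 c1d] ->] := diffq_mvt x d0 (DE _ _ (DE _ _ h1)).
  have [c2 /andP[xc2 c2d] ->] := diffq_mvt c1 d0 (DE _ _ h2).
  have [c3 /andP[xc3 c3d] ->] := diffq_mvt c2 d0 h3.
  by exists c3 => //; apply/andP; split; lra.
pose f := D (D (D G3)); pose f1 := D (D (D G2)).
pose f2 := D (D (D G1)); pose f3 := D (D (D g)).
have df : forall x, is_derive x 1 f (f1 x) by apply: DE; apply: DE; exact: DE.
have df1 : forall x, is_derive x 1 f1 (f2 x) by apply: DE; apply: DE; exact: DE.
have df2 : forall x, is_derive x 1 f2 (f3 x) by apply: DE; apply: DE; exact: DE.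
(* The mean value theorem absorbs one difference quotient per antiderivative; each remaining
   quotient costs a factor [2 / d]. *)
pose K1 := 2 * B / d; pose K2 := 2 * K1 / d; pose K3 := 2 * K2 / d.
have bf x : `|f x| <= B by have [c _] := D3 _ _ _ _ d3 d2 d1 x; rewrite -/f => ->.
have bf1 x : `|f1 x| <= K1.
  rewrite /f1 /D; have [c1 _ ->] := diffq_mvt x d0 (DE _ _ (DE _ _ d2)).
  have [c2 _ ->] := diffq_mvt c1 d0 (DE _ _ d1).
  exact: diffq_bound.
have bf2 x : `|f2 x| <= K2.
  rewrite /f2 /D; have [c1 _ ->] := diffq_mvt x d0 (DE _ _ (DE _ _ d1)).
  by apply: diffq_bound => //; exact: diffq_bound.
have bf3 x : `|f3 x| <= K3 by do 3 apply: diffq_bound => //.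
have K3_ge0 : 0 <= K3 by rewrite (le_trans _ (bf3 0)).
exists K3, f, f1, f2; split => //.
- exact: taylor_of_derive df df1 df2 bf bf1 bf2 bf3.
- move=> x; have [c /andP[xc cd] fE] := D3 _ _ _ _ d3 d2 d1 x.
  rewrite /f fE (le_trans (gL _ _))// ger0_norm ?subr_ge0//.
  apply: (@le_trans _ _ ((L + 1) * (3 * d))).
    by apply: ler_pM => //; [rewrite subr_ge0|rewrite lerDl|lra].
  by rewrite /d le_eqVlt; apply/orP; left; apply/eqP; field; rewrite gt_eqF.
Qed.

End differences.

Lemma bmf_dominated_cvg d (T : measurableType d) (R : realType)
    (P : probability T R) (f_ : nat -> T -> R) (f : T -> R) (M : R) :
  (forall n, measurable_fun setT (f_ n)) -> (forall n x, `|f_ n x| <= M) ->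
  bmf f -> (forall x, f_ n x @[n --> \oo] --> f x) ->
  \int[P]_x f_ n x @[n --> \oo] --> \int[P]_x f x.
Proof.
move=> mf_ f_M bf cf.
have iM := bmf_integrable P (bmf_cst T M).
have [//|||||_ _] := @dominated_convergence _ _ _ P setT measurableT
  (fun n x => (f_ n x)%:E) (EFin \o f) (fun=> M%:E).
- by move=> n; apply/measurable_EFinP.
- by apply/measurable_EFinP; case: bf.
- by apply: aeW => x _; apply: cvg_EFin; [exact: nearW|exact: cf].
- exact: iM.
- by apply: aeW => x n _; rewrite lee_fin.
rewrite [X in _ --> X -> _](bmf_integral P bf) => /fine_cvg.
exact.
Qed.

(** * Portmanteau *)

Section infimal_convolution.
Context (R : realType) (g : R -> R) (B : R).
Hypothesis gB : forall x, `|g x| <= B.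

(** The Pasch-Hausdorff envelope: for bounded [g] and [m >= 0], the largest [m]-Lipschitz minorant
    of [g]. *)
Definition infconv (m : R) (x : R) : R :=
  inf (range (fun y => g y + m * `|x - y|)).

Lemma infconv_lb m x : 0 <= m -> lbound (range (fun y => g y + m * `|x - y|)) (- B).
Proof.
move=> m0 _ [y _ <-]; have := gB y; rewrite ler_norml => /andP[gy _].
by rewrite (le_trans gy)// lerDl mulr_ge0.
Qed.

Lemma infconv_le m x y : 0 <= m -> infconv m x <= g y + m * `|x - y|.
Proof.
move=> m0; apply: ge_inf; last by exists y.
by exists (- B); exact: infconv_lb.
Qed.

Lemma infconv_ge m x c : (forall y, c <= g y + m * `|x - y|) -> c <= infconv m x.
Proof.
move=> H; apply: lb_le_inf; last by move=> _ [y _ <-].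
by exists (g 0 + m * `|x - 0|); exists 0.
Qed.

Lemma infconv_le_self m x : 0 <= m -> infconv m x <= g x.
Proof. by move=> /(infconv_le x x); rewrite subrr normr0 mulr0 addr0. Qed.

Lemma infconv_bound m x : 0 <= m -> `|infconv m x| <= B.
Proof.
move=> m0; rewrite ler_norml; apply/andP; split.
  by apply: infconv_ge => y; apply: (infconv_lb (x := x) m0); exists y.
rewrite (le_trans (infconv_le_self x m0))//.
by rewrite (le_trans (ler_norm _)).
Qed.

Lemma infconv_lipschitz m x y : 0 <= m ->
  `|infconv m x - infconv m y| <= m * `|x - y|.
Proof.
move=> m0; have key a b : infconv m a - m * `|a - b| <= infconv m b.
  apply: infconv_ge => z; rewrite lerBlDr.
  rewrite (le_trans (infconv_le a z m0))// -addrA lerD2l -mulrDr ler_wpM2l//.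
  by rewrite [leRHS]addrC (le_trans _ (ler_normD _ _))// subrKA.
rewrite ler_norml; have := key x y; have := key y x; rewrite distrC.
by move=> H1 H2; apply/andP; split; lra.
Qed.

(** Within distance [r] of [x], continuity bounds [g y] from below; beyond it the penalty is at
    least [n * r], which eventually exceeds the oscillation [2 * B]. *)
Lemma infconv_cvg x : {for x, continuous g} ->
  infconv n%:R x @[n --> \oo] --> g x.
Proof.
move=> cg; apply/cvgrPdist_le => /= e e0.
have /cvgrPdist_le/(_ e e0)/nbhs_ballP[r /= r0 H] := cg.
near=> n.
rewrite ger0_norm ?subr_ge0 ?infconv_le_self// lerBlDr -lerBlDl.
apply: infconv_ge => y.
have [xy|xy] := ltP `|x - y| r.
  have := H y xy; rewrite ler_norml => /andP[_ gy].
  have : 0 <= n%:R * `|x - y| by rewrite mulr_ge0.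
  by lra.
have nr : 2 * B <= n%:R * r.
  rewrite -ler_pdivrMr//; near: n; exact: nbhs_infty_ger.
have : n%:R * r <= n%:R * `|x - y| by rewrite ler_wpM2l.
have := gB x; have := gB y; rewrite !ler_norml => /andP[gy _] /andP[_ gx].
by lra.
Unshelve. all: by end_near. Qed.

End infimal_convolution.

(** A lower bound suffices, since it also applies to [- g]. It comes from a Lipschitz minorant of
    [g] with a fixed [m], chosen by dominated convergence under [mu] before [n] tends to
    infinity. *)
Lemma portmanteau_lipschitz d (T : measurableType d) (R : realType)
    (P : probability T R) (Y : nat -> T -> R)
    (mu : probability (measurableTypeR R) R) :
  (forall n, measurable_fun setT (Y n)) ->
  (forall (g : R -> R) (B L : R), 0 <= L -> (forall x, `|g x| <= B) ->
     (forall x y, `|g x - g y| <= L * `|x - y|) ->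
     \int[P]_w g (Y n w) @[n --> \oo] --> \int[mu]_x g x) ->
  forall g : R -> R, continuous g -> (exists M : R, forall x, `|g x| <= M) ->
    \int[P]_w g (Y n w) @[n --> \oo] --> \int[mu]_x g x.
Proof.
move=> mY H.
have lower (g : R -> R) B : continuous g -> (forall x, `|g x| <= B) ->
    forall e : R, 0 < e ->
    \forall n \near \oo, \int[mu]_x g x - e <= \int[P]_w g (Y n w).
  move=> cg gB e e0.
  have e20 : 0 < e / 2 by rewrite divr_gt0.
  have bg : bmf (g : measurableTypeR R -> R).
    by split; [exact: continuous_measurable_fun|exists B].
  have linf (m : nat) x y : `|infconv g m%:R x - infconv g m%:R y| <= m%:R * `|x - y|.
    exact: (infconv_lipschitz gB).
  have binf (m : nat) : bmf (infconv g m%:R : measurableTypeR R -> R).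
    split; last by exists B => x; exact: infconv_bound.
    apply: continuous_measurable_fun; exact: (lipschitz_continuous_real (ler0n R m)).
  have cm : \int[mu]_x infconv g m%:R x @[m --> \oo] --> \int[mu]_x g x.
    apply: (@bmf_dominated_cvg _ _ _ mu _ _ B) => //.
    - by move=> m; case: (binf m).
    - by move=> m x; exact: infconv_bound.
    - by move=> x; apply: (infconv_cvg gB); exact: cg.
  have [m Hm] : exists m : nat, \int[mu]_x g x - e / 2 <= \int[mu]_x infconv g m%:R x.
    have /cvgrPdist_le/(_ _ e20)[m _ Hm] := cm.
    exists m; have := Hm m (leqnn m); rewrite ler_norml => /andP[_].
    by rewrite lerBlDr -lerBlDl.
  have /cvgrPdist_le/(_ _ e20) := H _ B m%:R (ler0n _ m)
    (fun x => infconv_bound gB x (ler0n R m)) (linf m).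
  apply: filterS => n; rewrite ler_norml => /andP[_ Hn].
  have : \int[P]_w infconv g m%:R (Y n w) <= \int[P]_w g (Y n w).
    apply: bmf_le_Rintegral.
    - exact: (bmf_comp (binf m) (mY n)).
    - exact: (bmf_comp bg (mY n)).
    - by move=> w; exact: (infconv_le_self gB).
  by lra.
move=> g cg [B gB]; apply/cvgrPdist_le => /= e e0.
have bg : bmf (g : measurableTypeR R -> R).
  by split; [exact: continuous_measurable_fun|exists B].
have cNg : continuous (fun x => - g x) by move=> x; apply: cvgN; exact: cg.
have gNB x : `|- g x| <= B by rewrite normrN.
have L1 := lower _ _ cg gB _ e0.
have L2 := lower _ _ cNg gNB _ e0.
have NE (Q : probability (measurableTypeR R) R) : \int[Q]_x - g x = - \int[Q]_x g x.
  rewrite -mulN1r -bmf_RintegralZl//.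
  by apply: eq_Rintegral => x _; rewrite mulN1r.
have NEY n : \int[P]_w - g (Y n w) = - \int[P]_w g (Y n w).
  rewrite -mulN1r -bmf_RintegralZl; last exact: (bmf_comp bg (mY n)).
  by apply: eq_Rintegral => x _; rewrite mulN1r.
near=> n.
have H1 : \int[mu]_x g x - e <= \int[P]_w g (Y n w) by near: n.
have : \int[mu]_x - g x - e <= \int[P]_w - g (Y n w) by near: n.
rewrite NE NEY => H2; rewrite ler_norml; apply/andP; split; lra.
Unshelve. all: by end_near. Qed.

(** Since [g] is Lipschitz, the remainder [r] counts only through its L1 norm. Exchanging [g] for a
    smooth [f] costs [e / 4] under each of the two laws; the remainder and the replacement error are
    together below [e / 4] for large [n]. *)
Lemma clt_lipschitz d (T : measurableType d) (R : realType)
  (P : probability T R) (v M C : R) (xi r : nat -> T -> R) (g : R -> R) (B L : R) :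
  0 <= v -> 0 <= M -> 0 <= L ->
  (forall x, `|g x| <= B) -> (forall x y, `|g x - g y| <= L * `|x - y|) ->
  (forall j, measurable_fun setT (xi j)) -> (forall j w, `|xi j w| <= M) ->
  (forall n (phi : R -> R), bmf phi ->
     \int[P]_w (phi (\sum_(j < n) xi j w) * xi n w) = 0) ->
  (forall n (phi : R -> R), bmf phi ->
     \int[P]_w (phi (\sum_(j < n) xi j w) * xi n w ^+ 2) =
     v * \int[P]_w phi (\sum_(j < n) xi j w)) ->
  (forall n, bmf (r n)) ->
  (forall n, \int[P]_w `|r n w| <= C / Num.sqrt n.+1%:R) ->
  \int[P]_w g ((Num.sqrt n.+1%:R)^-1 * (\sum_(j < n.+1) xi j w) + r n w)
    @[n --> \oo] --> \int[centered_gaussian v]_x g x.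
Proof.
move=> v0 M0 L0 gB gL mxi xiM e1 e2 br rC.
apply/cvgrPdist_le => /= e e0.
have e40 : 0 < e / 4 by rewrite divr_gt0.
have [K [f [f1 [f2 [K0 tf fg]]]]] := taylor_approximation e40 L0 gB gL.
have cg := lipschitz_continuous_real L0 gL.
have bg : bmf g by split; [exact: continuous_measurable_fun|exists B].
have [bf _ _ _] := tf.
pose D := K * (16 * Num.sqrt v ^+ 3 + M ^+ 3).
have small : \forall n \near \oo, (L * C + D) / Num.sqrt n.+1%:R <= e / 4.
  pose c := (`|L * C + D| / (e / 4)) ^+ 2.
  near=> n.
  have cn : c <= n.+1%:R.
    rewrite (@le_trans _ _ n%:R)// ?ler_nat//; near: n; exact: nbhs_infty_ger.
  rewrite ler_pdivrMr// (le_trans (ler_norm _))// [leRHS]mulrC -ler_pdivrMr//.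
  have -> : `|L * C + D| / (e / 4) = Num.sqrt c.
    by rewrite sqrtr_sqr [RHS]ger0_norm//; apply: divr_ge0 => //; exact: ltW.
  by rewrite ler_sqrt.
apply: filterS small => n small.
set s := (Num.sqrt n.+1%:R)^-1.
pose A w := s * \sum_(j < n.+1) xi j w.
have mA : measurable_fun setT A.
  by apply: measurable_funM => //; apply: measurable_sum => j.
have bgA := bmf_comp bg mA; have bfA := bmf_comp bf mA.
have bgY : bmf (fun w => g (A w + r n w)).
  by apply: (bmf_comp bg); apply: measurable_funD => //; case: (br n).
have step1 : `|\int[P]_w g (A w + r n w) - \int[P]_w g (A w)| <= L * C * s.
  rewrite -bmf_RintegralB// (le_trans (bmf_ler_norm_Rintegral _ _))//.
    exact: bmfB.
  apply: (@le_trans _ _ (\int[P]_w (L * `|r n w|))).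
    apply: bmf_le_Rintegral.
    - by apply: bmf_norm; exact: bmfB.
    - by apply: bmfM => //; exact: bmf_norm.
    - by move=> w; rewrite (le_trans (gL _ _))// [A w + _]addrC addrK.
  by rewrite bmf_RintegralZl -?mulrA ?ler_wpM2l//; exact: bmf_norm.
have step2 : `|\int[P]_w g (A w) - \int[P]_w f (A w)| <= e / 4.
  rewrite -bmf_RintegralB//; apply: bmf_Rintegral_bound; first exact: bmfB.
  by move=> w; rewrite distrC.
have step3 : `|\int[P]_w f (A w) - \int[centered_gaussian v]_x f x| <= D * s.
  exact: (clt_taylor n v0 M0 K0 tf).
have step4 : `|\int[centered_gaussian v]_x f x - \int[centered_gaussian v]_x g x| <= e / 4.
  rewrite -(bmf_RintegralB (centered_gaussian v) bf bg).
  by apply: (bmf_Rintegral_bound (centered_gaussian v)) => //; exact: bmfB.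
rewrite mulrDl -/s in small; rewrite distrC.
move: step1 step2 step3 step4; rewrite !ler_norml.
move=> /andP[? ?] /andP[? ?] /andP[? ?] /andP[? ?].
by apply/andP; split; lra.
Unshelve. all: by end_near. Qed.

(** * Integrating out one independent variable, and orthogonality in L2 *)

Lemma g_sigma_algebra_preimage_measurable d d' (T : measurableType d)
    (T' : measurableType d') (Y : T -> T') : measurable_fun setT Y ->
  g_sigma_algebra_preimage Y `<=` measurable.
Proof. by move=> mY _ [B mB <-]; rewrite setTI; exact: measurable_preimageT. Qed.

Lemma sigma_algebra_g_preimage d d' (T : measurableType d)
    (T' : measurableType d') (Y : T -> T') :
  sigma_algebra setT (g_sigma_algebra_preimage Y).
Proof. exact/sigma_algebra_preimage/sigma_algebra_measurable. Qed.

(** Retyping the domain of [Y] expresses its measurability with respect to [<<s GG>>]. One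
    independence statement then serves every [Y] built from the remaining variables, and [Z] is
    exchanged for the reference variable [Z0]. *)
Lemma indep_Rintegral_sub d d1 d2 (T : measurableType d) (T1 : measurableType d1)
    (T2 : measurableType d2) (R : realType) (P : probability T R)
    (GG : set_system T) (Y : T -> T1) (Z Z0 : T -> T2) (H : T1 * T2 -> R) :
  GG `<=` measurable ->
  measurable_fun setT (Y : g_sigma_algebraType GG -> T1) ->
  measurable_fun setT Z -> measurable_fun setT Z0 -> same_law P Z Z0 ->
  independent2 P <<s GG>> (g_sigma_algebra_preimage Z) ->
  bmf H -> \int[P]_w H (Y w, Z w) = \int[P]_w \int[P]_w' H (Y w, Z0 w').
Proof.
move=> GGm mY mZ mZ0 ZZ0 GZ bH.
have GYG : g_sigma_algebra_preimage Y `<=` <<s GG>>.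
  by move=> _ [B mB <-]; exact: (mY measurableT B mB).
have mY' : measurable_fun setT Y.
  move=> _ B mB; apply: (sub_gen_measurable GGm).
  exact: (mY measurableT B mB).
rewrite (@indep_Rintegral _ _ _ _ _ _ _ P Y Z H mY' mZ _ bH); last first.
  exact: independent2S GYG (@subset_refl _ _) GZ.
apply: eq_Rintegral => w _.
exact: (Rintegral_law mZ mZ0 ZZ0 (bmf_pairr bH (Y w))).
Qed.

Lemma orthogonal_sum_sqr d (T : measurableType d) (R : realType)
    (P : probability T R) (I : finType) (K : I -> T -> R) (B : R) :
  (forall i, bmf (K i)) -> (forall i w, `|K i w| <= B) ->
  (forall i j, i != j -> \int[P]_w (K i w * K j w) = 0) ->
  \int[P]_w (\sum_i K i w) ^+ 2 <= #|I|%:R * B ^+ 2.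
Proof.
move=> bK KB H.
have bKK i j : bmf (fun w => K i w * K j w) by exact: bmfM.
have -> : \int[P]_w (\sum_i K i w) ^+ 2 =
    \sum_i \sum_j \int[P]_w (K i w * K j w).
  transitivity (\int[P]_w \sum_i \sum_j (K i w * K j w)).
    by apply: eq_Rintegral => w _; rewrite expr2 big_distrlr.
  rewrite bmf_Rintegral_sum => [|i]; last exact: bmf_sum.
  by apply: eq_bigr => i _; rewrite bmf_Rintegral_sum.
have -> : #|I|%:R * B ^+ 2 = \sum_(i : I) B ^+ 2.
  by rewrite sumr_const mulr_natl.
apply: ler_sum => i _; rewrite (bigD1 i)//= big1 => [|j ji]; last first.
  by apply: H; rewrite eq_sym.
rewrite addr0 -[leRHS](prob_Rintegral_cst P).
apply: bmf_le_Rintegral => // w.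
by rewrite -expr2 -real_normK ?num_real// lerXn2r ?nnegrE// (le_trans _ (KB i w)).
Qed.

(** The pointwise bound of [|f|] by [q / 2 + f ^+ 2 / (2 * q)], integrated, takes the place of the
    Cauchy-Schwarz inequality. *)
Lemma L1_of_L2 d (T : measurableType d) (R : realType) (P : probability T R)
    (f : T -> R) (q : R) : bmf f -> 0 < q -> \int[P]_w f w ^+ 2 <= q ^+ 2 ->
  \int[P]_w `|f w| <= q.
Proof.
move=> bf q0 H; have bf2 := bmfX 2 bf.
have bf2q : bmf (fun w => (2 * q)^-1 * f w ^+ 2) by apply: bmfM.
apply: (@le_trans _ _ (\int[P]_w (q / 2 + (2 * q)^-1 * f w ^+ 2))).
  apply: bmf_le_Rintegral; [exact: bmf_norm|exact: bmfD|move=> w].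
  rewrite -(ler_pM2l (_ : 0 < 2 * q)) ?mulr_gt0//.
  have -> : 2 * q * (q / 2 + (2 * q)^-1 * f w ^+ 2) = q ^+ 2 + `|f w| ^+ 2.
    by rewrite real_normK ?num_real//; field; rewrite gt_eqF.
  by have := sqr_ge0 (q - `|f w|); rewrite sqrrB; lra.
rewrite bmf_RintegralD// prob_Rintegral_cst bmf_RintegralZl//.
have : (2 * q)^-1 * \int[P]_w f w ^+ 2 <= (2 * q)^-1 * q ^+ 2.
  by rewrite ler_pM2l// invr_gt0 mulr_gt0.
have -> : (2 * q)^-1 * q ^+ 2 = q / 2 by field; rewrite gt_eqF.
by lra.
Qed.

(** * The limit theorem for the two-sample statistic *)

Section two_samples.
Context d dZ dW (T : measurableType d) (TZ : measurableType dZ)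
  (TW : measurableType dW) (R : realType) (P : probability T R).
Context (zeta : nat -> T -> TZ) (W : nat -> T -> TW) (Z0 : T -> TZ) (W0 : T -> TW).
Hypotheses (mzeta : forall j, measurable_fun setT (zeta j))
  (mW : forall l, measurable_fun setT (W l))
  (mZ0 : measurable_fun setT Z0) (mW0 : measurable_fun setT W0).
Hypotheses (lzeta : forall j, same_law P (zeta j) Z0)
  (lW : forall l, same_law P (W l) W0).
Hypotheses (izeta : independent P [set: nat] (fun j => g_sigma_algebra_preimage (zeta j)))
  (iW : independent P [set: nat] (fun l => g_sigma_algebra_preimage (W l)))
  (izW : independent2 P (sigma_seq zeta) (sigma_seq W)).

Let others d' (T' : measurableType d') (Y : nat -> T -> T') (k : nat) : set_system T :=
  <<s \bigcup_(j in [set j | j <> k]) g_sigma_algebra_preimage (Y j)>>.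

Let sigma_seq_sub d' (T' : measurableType d') (Y : nat -> T -> T') :
  (forall j, measurable_fun setT (Y j)) -> sigma_seq Y `<=` measurable.
Proof.
move=> mY; apply: sub_gen_measurable => A [j _].
exact: g_sigma_algebra_preimage_measurable.
Qed.

Let preimage_sigma_seq d' (T' : measurableType d') (Y : nat -> T -> T') j :
  g_sigma_algebra_preimage (Y j) `<=` sigma_seq Y.
Proof. by move=> A YA; apply: sub_sigma_algebra; exists j. Qed.

Let others_sub d' (T' : measurableType d') (Y : nat -> T -> T') k :
  others Y k `<=` sigma_seq Y.
Proof.
apply: smallest_sub; first exact: smallest_sigma_algebra.
by move=> A [j _ YA]; exact: preimage_sigma_seq YA.
Qed.

Let indep_others d' (T' : measurableType d') (Y : nat -> T -> T') k :
  (forall j, measurable_fun setT (Y j)) ->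
  independent P [set: nat] (fun j => g_sigma_algebra_preimage (Y j)) ->
  independent2 P (g_sigma_algebra_preimage (Y k)) (others Y k).
Proof.
move=> mY iY; apply: (@independent2S _ _ _ _ _
    <<s \bigcup_(j in [set k]) g_sigma_algebra_preimage (Y j)>> _ (others Y k)).
- by move=> A YA; apply: sub_sigma_algebra; exists k.
- exact: subset_refl.
- apply: (independent_blocks _ _ iY) => //.
  + by move=> j; exact: sigma_algebra_g_preimage.
  + by move=> j; exact: g_sigma_algebra_preimage_measurable.
  + by apply/seteqP; split=> j //= [-> /(_ erefl)].
Qed.

(** Generators of all the randomness except [zeta k]: the other pairs together with the whole second
    sample. [restW] exchanges the roles. *)
Let restZ k : set_system T := others zeta k `|` sigma_seq W.
Let restW k : set_system T := others W k `|` sigma_seq zeta.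

Let restZ_measurable k : restZ k `<=` measurable.
Proof.
move=> A [/others_sub|]; exact: sigma_seq_sub.
Qed.

Let restW_measurable k : restW k `<=` measurable.
Proof.
move=> A [/others_sub|]; exact: sigma_seq_sub.
Qed.

Let sigma_seq_setI d' (T' : measurableType d') (Y : nat -> T -> T') :
  setI_closed (sigma_seq Y).
Proof.
move=> A B YA YB.
exact: (@measurableI _ (g_sigma_algebraType
  (\bigcup_j g_sigma_algebra_preimage (Y j)))).
Qed.

Let indep_restZ k : independent2 P <<s restZ k>> (g_sigma_algebra_preimage (zeta k)).
Proof.
apply/independent2C; apply: (@independent2_join _ _ _ _ _ _ (sigma_seq zeta)).
- exact: smallest_sigma_algebra.
- exact: smallest_sigma_algebra.
- exact: sigma_seq_setI.
- exact: preimage_sigma_seq.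
- exact: others_sub.
- exact: sigma_seq_sub.
- exact: sigma_seq_sub.
- exact: indep_others.
- exact: izW.
Qed.

Let indep_restW k : independent2 P <<s restW k>> (g_sigma_algebra_preimage (W k)).
Proof.
apply/independent2C; apply: (@independent2_join _ _ _ _ _ _ (sigma_seq W)).
- exact: smallest_sigma_algebra.
- exact: smallest_sigma_algebra.
- exact: sigma_seq_setI.
- exact: preimage_sigma_seq.
- exact: others_sub.
- exact: sigma_seq_sub.
- exact: sigma_seq_sub.
- exact: indep_others.
- exact/independent2C.
Qed.

Let mzeta_restZ j k : j <> k ->
  measurable_fun setT (zeta j : g_sigma_algebraType (restZ k) -> TZ).
Proof.
move=> jk _ B mB; apply: sub_sigma_algebra; left.
by apply: sub_sigma_algebra; exists j => //; exists B.
Qed.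

Let mW_restZ l k : measurable_fun setT (W l : g_sigma_algebraType (restZ k) -> TW).
Proof.
move=> _ B mB; apply: sub_sigma_algebra; right.
by apply: sub_sigma_algebra; exists l => //; exists B.
Qed.

Let mW_restW j k : j <> k ->
  measurable_fun setT (W j : g_sigma_algebraType (restW k) -> TW).
Proof.
move=> jk _ B mB; apply: sub_sigma_algebra; left.
by apply: sub_sigma_algebra; exists j => //; exists B.
Qed.

Let mzeta_restW l k :
  measurable_fun setT (zeta l : g_sigma_algebraType (restW k) -> TZ).
Proof.
move=> _ B mB; apply: sub_sigma_algebra; right.
by apply: sub_sigma_algebra; exists l => //; exists B.
Qed.

(** In the rest of the section independence enters only through this identity and its analogue for
    [W]. *)
Lemma Rintegral_zeta k d' (T' : measurableType d') (Y : T -> T') (H : T' * TZ -> R) :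
  measurable_fun setT (Y : g_sigma_algebraType (restZ k) -> T') -> bmf H ->
  \int[P]_w H (Y w, zeta k w) = \int[P]_w \int[P]_w' H (Y w, Z0 w').
Proof.
move=> mY bH; exact: (indep_Rintegral_sub (@restZ_measurable k) mY (mzeta k) mZ0
  (lzeta k) (@indep_restZ k) bH).
Qed.

Lemma Rintegral_W k d' (T' : measurableType d') (Y : T -> T') (H : T' * TW -> R) :
  measurable_fun setT (Y : g_sigma_algebraType (restW k) -> T') -> bmf H ->
  \int[P]_w H (Y w, W k w) = \int[P]_w \int[P]_w' H (Y w, W0 w').
Proof.
move=> mY bH; exact: (indep_Rintegral_sub (@restW_measurable k) mY (mW k) mW0
  (lW k) (@indep_restW k) bH).
Qed.

Section linear_part.
Context (a : TZ -> R) (b : TW -> R).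
Hypotheses (ba : bmf a) (bb : bmf b).
Hypotheses (a0 : \int[P]_w a (Z0 w) = 0) (b0 : \int[P]_w b (W0 w) = 0).

(** Pairing the samples index by index produces one sequence of independent terms, so a single
    replacement argument treats both. *)
Let xi j w := a (zeta j w) + b (W j w).

Let sum_restZ n :
  measurable_fun setT ((fun w => \sum_(j < n) xi j w) : g_sigma_algebraType (restZ n) -> R).
Proof.
apply: measurable_sum => j; have jn : (j : nat) <> n.
  by apply/eqP; rewrite ltn_eqF.
apply: measurable_funD.
  exact: (measurableT_comp (bmf_measurable ba) (mzeta_restZ jn)).
exact: (measurableT_comp (bmf_measurable bb) (@mW_restZ j n)).
Qed.

Let sum_restW n :
  measurable_fun setT ((fun w => \sum_(j < n) xi j w) : g_sigma_algebraType (restW n) -> R).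
Proof.
apply: measurable_sum => j; have jn : (j : nat) <> n.
  by apply/eqP; rewrite ltn_eqF.
apply: measurable_funD.
  exact: (measurableT_comp (bmf_measurable ba) (@mzeta_restW j n)).
exact: (measurableT_comp (bmf_measurable bb) (mW_restW jn)).
Qed.

Let S n w := \sum_(j < n) xi j w.

Let bxi j : bmf (xi j).
Proof. by apply: bmfD; apply: bmf_comp. Qed.

Let bS n (phi : R -> R) : bmf phi -> bmf (fun w => phi (S n w)).
Proof.
move=> bphi; apply: (bmf_comp bphi); apply: measurable_sum => j.
exact: bmf_measurable.
Qed.

Let Ephi_zeta n (phi : R -> R) (h : TZ -> R) : bmf phi -> bmf h ->
  \int[P]_w (phi (S n w) * h (zeta n w)) =
  \int[P]_w h (Z0 w) * \int[P]_w phi (S n w).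
Proof.
move=> bphi bh; pose H (z : R * TZ) := phi z.1 * h z.2.
have bH : bmf H.
  by apply: bmfM; [apply: (bmf_comp bphi)|apply: (bmf_comp bh)].
rewrite (Rintegral_zeta (Y := S n) (H := H) (@sum_restZ n) bH) /H/=.
have bhZ : bmf (fun w => h (Z0 w)) by exact: bmf_comp.
under eq_Rintegral do rewrite bmf_RintegralZl//.
rewrite (bmf_RintegralZr P _ (bS n bphi)); exact: mulrC.
Qed.

Let Ephi_W n (phi : R -> R) (h : TW -> R) : bmf phi -> bmf h ->
  \int[P]_w (phi (S n w) * h (W n w)) =
  \int[P]_w h (W0 w) * \int[P]_w phi (S n w).
Proof.
move=> bphi bh; pose H (z : R * TW) := phi z.1 * h z.2.
have bH : bmf H.
  by apply: bmfM; [apply: (bmf_comp bphi)|apply: (bmf_comp bh)].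
rewrite (Rintegral_W (Y := S n) (H := H) (@sum_restW n) bH) /H/=.
have bhW : bmf (fun w => h (W0 w)) by exact: bmf_comp.
under eq_Rintegral do rewrite bmf_RintegralZl//.
rewrite (bmf_RintegralZr P _ (bS n bphi)); exact: mulrC.
Qed.

(** [W n] belongs to the variables other than [zeta n], so [zeta n] is integrated out with the pair
    [(S n, W n)] held fixed, and [a] is centered. *)
Let Ephi_cross n (phi : R -> R) : bmf phi ->
  \int[P]_w (phi (S n w) * b (W n w) * a (zeta n w)) = 0.
Proof.
move=> bphi; pose H (z : (R * TW) * TZ) := phi z.1.1 * b z.1.2 * a z.2.
have bH : bmf H.
  apply: bmfM; last by apply: (bmf_comp ba).
  apply: bmfM; last by apply: (bmf_comp bb); exact: measurableT_comp.
  by apply: (bmf_comp bphi); exact: measurableT_comp.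
have mY : measurable_fun setT
    ((fun w => (S n w, W n w)) : g_sigma_algebraType (restZ n) -> R * TW).
  by apply: measurable_fun_pair; [exact: sum_restZ|exact: mW_restZ].
rewrite (Rintegral_zeta (H := H) mY bH) /H/=.
have bZ : bmf (fun w => a (Z0 w)) by exact: bmf_comp.
under eq_Rintegral do rewrite bmf_RintegralZl// a0 mulr0.
exact: prob_Rintegral_cst.
Qed.

Lemma linear_part_first n (phi : R -> R) : bmf phi ->
  \int[P]_w (phi (S n w) * xi n w) = 0.
Proof.
move=> bphi; under eq_Rintegral do rewrite mulrDr.
rewrite bmf_RintegralD; try by apply: bmfM; [exact: bS|exact: bmf_comp].
by rewrite (Ephi_zeta _ bphi ba) (Ephi_W _ bphi bb) a0 b0 !mul0r addr0.
Qed.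

Lemma linear_part_second n (phi : R -> R) : bmf phi ->
  \int[P]_w (phi (S n w) * xi n w ^+ 2) =
  (\int[P]_w a (Z0 w) ^+ 2 + \int[P]_w b (W0 w) ^+ 2) * \int[P]_w phi (S n w).
Proof.
move=> bphi.
have baz : bmf (fun w => a (zeta n w)) by exact: bmf_comp.
have bbw : bmf (fun w => b (W n w)) by exact: bmf_comp.
have ba2 : bmf (fun z => a z ^+ 2) by exact: bmfX.
have bb2 : bmf (fun z => b z ^+ 2) by exact: bmfX.
have bSn := bS n bphi.
transitivity (\int[P]_w (phi (S n w) * (a (zeta n w) ^+ 2)
   + phi (S n w) * (b (W n w) ^+ 2)
   + 2 * (phi (S n w) * b (W n w) * a (zeta n w)))).
  by apply: eq_Rintegral => w _; rewrite /xi; ring.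
have b1 : bmf (fun w => phi (S n w) * (a (zeta n w) ^+ 2)).
  by apply: bmfM => //; exact: bmfX.
have b2 : bmf (fun w => phi (S n w) * (b (W n w) ^+ 2)).
  by apply: bmfM => //; exact: bmfX.
have b3 : bmf (fun w => phi (S n w) * b (W n w) * a (zeta n w)).
  by do ?apply: bmfM.
rewrite bmf_RintegralD; [|exact: bmfD|by apply: bmfM].
rewrite bmf_RintegralD// bmf_RintegralZl// Ephi_cross// mulr0 addr0.
by rewrite (Ephi_zeta _ bphi ba2) (Ephi_W _ bphi bb2) mulrDl.
Qed.

End linear_part.

(** If [j = j'], then [W l] occurs in the first factor only; otherwise [zeta j] does. Integrating
    out that variable makes the first factor vanish by the corresponding centering. *)
Lemma degenerate_orthogonal (kap : TZ * TW -> R) (j l j' l' : nat) : bmf kap ->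
  (forall t, \int[P]_w kap (Z0 w, t) = 0) -> (forall z, \int[P]_w kap (z, W0 w) = 0) ->
  (j, l) != (j', l') ->
  \int[P]_w (kap (zeta j w, W l w) * kap (zeta j' w, W l' w)) = 0.
Proof.
move=> bk k1 k2.
have bkl t : bmf (fun w => kap (Z0 w, t)).
  by apply: (bmf_comp bk); exact: measurable_fun_pair.
have bkr z : bmf (fun w => kap (z, W0 w)).
  by apply: (bmf_comp bk); exact: measurable_fun_pair.
rewrite xpair_eqE negb_and; have [->/= ll'|jj' _] := eqVneq j j'.
  have {}ll' : l' <> l by apply/eqP; rewrite eq_sym.
  pose H (z : (TZ * (TZ * TW)) * TW) := kap (z.1.1, z.2) * kap z.1.2.
  have mY : measurable_fun setT ((fun w => (zeta j' w, (zeta j' w, W l' w)))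
      : g_sigma_algebraType (restW l) -> TZ * (TZ * TW)).
    apply: measurable_fun_pair; first exact: mzeta_restW.
    by apply: measurable_fun_pair; [exact: mzeta_restW|exact: mW_restW].
  have bH : bmf H.
    apply: bmfM; last by apply: (bmf_comp bk); exact: measurableT_comp.
    apply: (bmf_comp bk); apply: measurable_fun_pair; last by [].
    exact: measurableT_comp.
  rewrite (Rintegral_W (H := H) mY bH) /H/=.
  under eq_Rintegral do rewrite bmf_RintegralZr// k2 mul0r.
  exact: prob_Rintegral_cst.
have {}jj' : j' <> j by apply/eqP; rewrite eq_sym.
pose H (z : (TW * (TZ * TW)) * TZ) := kap (z.2, z.1.1) * kap z.1.2.
have mY : measurable_fun setT ((fun w => (W l w, (zeta j' w, W l' w)))
    : g_sigma_algebraType (restZ j) -> TW * (TZ * TW)).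
  apply: measurable_fun_pair; first exact: mW_restZ.
  by apply: measurable_fun_pair; [exact: mzeta_restZ|exact: mW_restZ].
have bH : bmf H.
  apply: bmfM; last by apply: (bmf_comp bk); exact: measurableT_comp.
  apply: (bmf_comp bk); apply: measurable_fun_pair; first by [].
  exact: measurableT_comp.
rewrite (Rintegral_zeta (H := H) mY bH) /H/=.
under eq_Rintegral do rewrite bmf_RintegralZr// k1 mul0r.
exact: prob_Rintegral_cst.
Qed.

Lemma conditionally_centered_orthogonal (c : TZ * TW -> R) (j j' l : nat) : bmf c ->
  (forall t, \int[P]_w c (Z0 w, t) = 0) -> j != j' ->
  \int[P]_w (c (zeta j w, W l w) * c (zeta j' w, W l w)) = 0.
Proof.
move=> bc c1 jj.
have bcl t : bmf (fun w => c (Z0 w, t)).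
  by apply: (bmf_comp bc); exact: measurable_fun_pair.
have {}jj : j' <> j by apply/eqP; rewrite eq_sym.
pose H (z : (TW * TZ) * TZ) := c (z.2, z.1.1) * c (z.1.2, z.1.1).
have mY : measurable_fun setT ((fun w => (W l w, zeta j' w))
    : g_sigma_algebraType (restZ j) -> TW * TZ).
  by apply: measurable_fun_pair; [exact: mW_restZ|exact: mzeta_restZ].
have bH : bmf H.
  apply: bmfM; apply: (bmf_comp bc); apply: measurable_fun_pair => //;
  exact: measurableT_comp.
rewrite (Rintegral_zeta (H := H) mY bH) /H/=.
under eq_Rintegral do rewrite bmf_RintegralZr// c1 mul0r.
exact: prob_Rintegral_cst.
Qed.

(* [zeta j] is the pick-freeze pair and [W l] the evaluation point; [a] and [b] are
   the two Hoeffding projections of the expansion of the statistic, [kap] is its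
   doubly centered part. *)
Section statistic.
Context (e s : TZ * TW -> R).
Hypotheses (be : bmf e) (bs : bmf s).

Let F t := \int[P]_w s (Z0 w, t).
Let G t := \int[P]_w e (Z0 w, t).
Let theta := \int[P]_w (G (W0 w) - F (W0 w) ^+ 2).
Let b t := G t - F t ^+ 2 - theta.
(** The first-order part of the expansion for a fixed evaluation point: the fluctuation of [e]
    around [G], minus the linear term of the square around [F]. The deviation [c] carries the
    quadratic term. *)
Let k (z : TZ * TW) := e z - G z.2 - 2 * F z.2 * (s z - F z.2).
Let a z := \int[P]_w k (z, W0 w).
Let kap (z : TZ * TW) := k z - a z.1.
Let c (z : TZ * TW) := s z - F z.2.

Let bF : bmf F.
Proof.
have bf : bmf (fun z : TW * T => s (Z0 z.2, z.1)).
  apply: (bmf_comp bs); apply: measurable_fun_pair => //.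
  exact: measurableT_comp.
exact: (bmf_Rintegralr P bf).
Qed.

Let bG : bmf G.
Proof.
have bf : bmf (fun z : TW * T => e (Z0 z.2, z.1)).
  apply: (bmf_comp be); apply: measurable_fun_pair => //.
  exact: measurableT_comp.
exact: (bmf_Rintegralr P bf).
Qed.

Let bsnd (h : TW -> R) : bmf h -> bmf (fun z : TZ * TW => h z.2).
Proof. by move=> bh; apply: (bmf_comp bh). Qed.

Let bfst (h : TZ -> R) : bmf h -> bmf (fun z : TZ * TW => h z.1).
Proof. by move=> bh; apply: (bmf_comp bh). Qed.

Let bc : bmf c. Proof. by apply: bmfB => //; exact: bsnd. Qed.

Let bk : bmf k.
Proof.
apply: bmfB; first by apply: bmfB => //; exact: bsnd.
by apply: bmfM => //; apply: bmfM => //; exact: bsnd.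
Qed.

Let ba : bmf a.
Proof.
have bf : bmf (fun z : TZ * T => k (z.1, W0 z.2)).
  apply: (bmf_comp bk); apply: measurable_fun_pair => //.
  exact: measurableT_comp.
exact: (bmf_Rintegralr P bf).
Qed.

Let bb : bmf b.
Proof. by apply: bmfB => //; apply: bmfB => //; exact: bmfX. Qed.

Let bkap : bmf kap. Proof. by apply: bmfB => //; exact: bfst. Qed.

Let bl (h : TZ * TW -> R) t : bmf h -> bmf (fun w => h (Z0 w, t)).
Proof. by move=> bh; apply: (bmf_comp bh); exact: measurable_fun_pair. Qed.

Let br (h : TZ * TW -> R) z : bmf h -> bmf (fun w => h (z, W0 w)).
Proof. by move=> bh; apply: (bmf_comp bh); exact: measurable_fun_pair. Qed.

Let c_centered t : \int[P]_w c (Z0 w, t) = 0.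
Proof.
rewrite /c/= bmf_RintegralB//; last exact: (bl t bs).
by rewrite prob_Rintegral_cst subrr.
Qed.

Let k_centered t : \int[P]_w k (Z0 w, t) = 0.
Proof.
have bet := bl t be; have bct := bl t bc.
have E : \int[P]_w k (Z0 w, t) =
    \int[P]_w (e (Z0 w, t) - G t - 2 * F t * c (Z0 w, t)) by [].
rewrite E bmf_RintegralB; [|exact: bmfB|by apply: bmfM].
rewrite bmf_RintegralB// bmf_RintegralZl// c_centered mulr0 subr0.
by rewrite prob_Rintegral_cst subrr.
Qed.

Let a_centered : \int[P]_w a (Z0 w) = 0.
Proof.
have bf : bmf (fun z : T * T => k (Z0 z.1, W0 z.2)).
  by apply: (bmf_comp bk); apply: measurable_fun_pair; exact: measurableT_comp.
have := bmf_fubini1 P P bf; rewrite (bmf_fubini2 P P bf)/= -/a => E.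
rewrite /a -E; under eq_Rintegral do rewrite k_centered.
exact: prob_Rintegral_cst.
Qed.

Let b_centered : \int[P]_w b (W0 w) = 0.
Proof.
have bGW : bmf (fun w => G (W0 w) - F (W0 w) ^+ 2).
  by apply: bmfB; [|apply: bmfX]; exact: bmf_comp.
by rewrite bmf_RintegralB// prob_Rintegral_cst subrr.
Qed.

Let kap_centeredl t : \int[P]_w kap (Z0 w, t) = 0.
Proof.
rewrite bmf_RintegralB; [|exact: bl|exact: bmf_comp].
by rewrite k_centered a_centered subrr.
Qed.

Let kap_centeredr z : \int[P]_w kap (z, W0 w) = 0.
Proof.
have E : \int[P]_w kap (z, W0 w) = \int[P]_w (k (z, W0 w) - a z) by [].
rewrite E (bmf_RintegralB P (br z bk) (bmf_cst T (a z))) -/(a z).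
by rewrite prob_Rintegral_cst subrr.
Qed.

Definition pick_freeze_estimator (N : nat) (w : T) : R :=
  N%:R^-1 * \sum_(l < N) (N%:R^-1 * (\sum_(j < N) e (zeta j w, W l w))
    - (N%:R^-1 * \sum_(j < N) s (zeta j w, W l w)) ^+ 2).

Let n_ n : R := n.+1%:R.
Let D n w := \sum_(p : 'I_n.+1 * 'I_n.+1) kap (zeta p.1 w, W p.2 w).
Let C n l w := \sum_(j < n.+1) c (zeta j w, W l w).
Let r n w := Num.sqrt (n_ n) *
  ((n_ n)^-1 ^+ 2 * D n w - (n_ n)^-1 * \sum_(l < n.+1) ((n_ n)^-1 * C n l w) ^+ 2).

Let mean_cst n (x : R) : (n_ n)^-1 * \sum_(j < n.+1) x = x.
Proof.
by rewrite sumr_const card_ord -[x *+ _]mulr_natl mulrA mulVf ?mul1r// pnatr_eq0.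
Qed.

Let estimator_decomposition n w :
  Num.sqrt (n_ n) * (pick_freeze_estimator n.+1 w - theta) =
  (Num.sqrt (n_ n))^-1 * \sum_(j < n.+1) (a (zeta j w) + b (W j w)) + r n w.
Proof.
rewrite /pick_freeze_estimator -/(n_ n).
have s0 : Num.sqrt (n_ n) != 0 by rewrite gt_eqF// sqrtr_gt0.
have s2 : Num.sqrt (n_ n) ^+ 2 = n_ n by rewrite sqr_sqrtr.
have main (l : 'I_n.+1) :
    (n_ n)^-1 * (\sum_(j < n.+1) e (zeta j w, W l w))
    - ((n_ n)^-1 * \sum_(j < n.+1) s (zeta j w, W l w)) ^+ 2 =
    theta + b (W l w) + (n_ n)^-1 * (\sum_(j < n.+1) kap (zeta j w, W l w))
    + (n_ n)^-1 * (\sum_(j < n.+1) a (zeta j w))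
    - ((n_ n)^-1 * C n l w) ^+ 2.
  set t := W l w.
  have -> : C n l w = \sum_(j < n.+1) s (zeta j w, t) - \sum_(j < n.+1) F t.
    by rewrite -sumrB.
  have -> : \sum_(j < n.+1) kap (zeta j w, t) =
      \sum_(j < n.+1) e (zeta j w, t) - \sum_(j < n.+1) G t
      - 2 * F t * (\sum_(j < n.+1) s (zeta j w, t) - \sum_(j < n.+1) F t)
      - \sum_(j < n.+1) a (zeta j w).
    by rewrite -!sumrB mulr_sumr -!sumrB.
  rewrite !mulrBr !(mulrCA _ (2 * F t)) !mean_cst /b.
  by ring.
(* An opaque copy of [b] keeps the sum of the [b (W l w)] whole while the other sums are split. *)
have [b' bE] : exists b', b' = b by exists b.
rewrite -bE in main *; under eq_bigr do rewrite main.
rewrite sumrB !big_split/= !mulrBr !mulrDr !mean_cst.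
have -> : (n_ n)^-1 * (\sum_(i < n.+1) (n_ n)^-1 * \sum_(j < n.+1) kap (zeta j w, W i w))
    = (n_ n)^-1 ^+ 2 * D n w.
  rewrite /D -mulr_sumr mulrA expr2; congr (_ * _).
  rewrite exchange_big/=.
  by rewrite (pair_bigA _ (fun j i : 'I_n.+1 => kap (zeta j w, W i w))).
rewrite /r !mulrBr.
have -> : (Num.sqrt (n_ n))^-1 = Num.sqrt (n_ n) * (n_ n)^-1.
  by rewrite -[X in _ / X]s2 expr2 invfM mulVKf.
by ring.
Qed.

Let bkapz j l : bmf (fun w => kap (zeta j w, W l w)).
Proof. by apply: (bmf_comp bkap); exact: measurable_fun_pair. Qed.

Let bcz j l : bmf (fun w => c (zeta j w, W l w)).
Proof. by apply: (bmf_comp bc); exact: measurable_fun_pair. Qed.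

Let bD n : bmf (D n). Proof. exact: bmf_sum. Qed.

Let bC n l : bmf (C n l). Proof. exact: bmf_sum. Qed.

Let b_r n : bmf (r n).
Proof.
apply: bmfM => //; apply: bmfB; first exact: bmfM.
by apply: bmfM => //; apply: bmf_sum => l; apply: bmfX; exact: bmfM.
Qed.

(** Write m for [n.+1]. [D] has m^2 pairwise orthogonal terms bounded by [B1], so [D] / m^2 has L2
    norm at most [B1] / m. Each [C] has m orthogonal terms bounded by [B2], so the square of [C] / m
    has mean at most [B2 ^+ 2] / m. The factor sqrt m then leaves 1 / sqrt m. *)
Let remainder_bound : exists K : R, forall n,
  \int[P]_w `|r n w| <= K / Num.sqrt n.+1%:R.
Proof.
have [B1 B10 kapB] := bmf_bound bkap.
have [B2 B20 cB] := bmf_bound bc.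
exists (B1 + B2 ^+ 2) => n.
have s0 : 0 < Num.sqrt (n_ n) by rewrite sqrtr_gt0.
have s2 : Num.sqrt (n_ n) ^+ 2 = n_ n by rewrite sqr_sqrtr.
have ED : \int[P]_w `|(n_ n)^-1 ^+ 2 * D n w| <= B1 / n_ n.
  apply: L1_of_L2; [by apply: bmfM|by rewrite divr_gt0|].
  have -> : \int[P]_w ((n_ n)^-1 ^+ 2 * D n w) ^+ 2 =
      (n_ n)^-1 ^+ 4 * \int[P]_w D n w ^+ 2.
    rewrite -bmf_RintegralZl; last exact: bmfX.
    by apply: eq_Rintegral => w _; rewrite exprMn -exprM.
  have -> : (B1 / n_ n) ^+ 2 = (n_ n)^-1 ^+ 4 * ((n_ n * n_ n) * B1 ^+ 2).
    by field; rewrite gt_eqF.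
  rewrite ler_pM2l ?exprn_gt0 ?invr_gt0//.
  have := @orthogonal_sum_sqr _ T R P ('I_n.+1 * 'I_n.+1)%type
    (fun p w => kap (zeta p.1 w, W p.2 w)) B1.
  rewrite card_prod card_ord natrM; apply => //.
  move=> [j l] [j' l'] /= H.
  apply: (degenerate_orthogonal bkap kap_centeredl kap_centeredr).
  by move: H; rewrite !xpair_eqE -!val_eqE.
have EC (l : 'I_n.+1) : \int[P]_w ((n_ n)^-1 * C n l w) ^+ 2 <= B2 ^+ 2 / n_ n.
  have -> : \int[P]_w ((n_ n)^-1 * C n l w) ^+ 2 =
      (n_ n)^-1 ^+ 2 * \int[P]_w C n l w ^+ 2.
    rewrite -bmf_RintegralZl; last exact: bmfX.
    by apply: eq_Rintegral => w _; rewrite exprMn.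
  have -> : B2 ^+ 2 / n_ n = (n_ n)^-1 ^+ 2 * (n_ n * B2 ^+ 2).
    by field; rewrite gt_eqF.
  rewrite ler_pM2l ?exprn_gt0 ?invr_gt0//.
  have := @orthogonal_sum_sqr _ T R P 'I_n.+1 (fun j w => c (zeta j w, W l w)) B2.
  rewrite card_ord; apply => //.
  by move=> j j' jj'; apply: conditionally_centered_orthogonal.
pose Q w := (n_ n)^-1 * \sum_(l < n.+1) ((n_ n)^-1 * C n l w) ^+ 2.
have bQl (l : 'I_n.+1) : bmf (fun w => ((n_ n)^-1 * C n l w) ^+ 2).
  by apply: bmfX; exact: bmfM.
have bQ : bmf Q by apply: bmfM => //; exact: bmf_sum.
have Q0 w : 0 <= Q w.
  by rewrite mulr_ge0 ?invr_ge0// sumr_ge0// => l _; exact: sqr_ge0.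
have EQ : \int[P]_w Q w <= B2 ^+ 2 / n_ n.
  rewrite bmf_RintegralZl; last exact: bmf_sum.
  rewrite bmf_Rintegral_sum//.
  rewrite -[leRHS](mean_cst n).
  by rewrite ler_pM2l ?invr_gt0//; apply: ler_sum.
have bDn : bmf (fun w => `|(n_ n)^-1 ^+ 2 * D n w|).
  by apply: bmf_norm; exact: bmfM.
apply: (@le_trans _ _ (\int[P]_w (Num.sqrt (n_ n) *
    (`|(n_ n)^-1 ^+ 2 * D n w| + Q w)))).
  apply: bmf_le_Rintegral; [exact: bmf_norm|by apply: bmfM => //; exact: bmfD|].
  move=> w; rewrite /r normrM ger0_norm// ler_pM2l//.
  by rewrite (le_trans (ler_normB _ _))// lerD2l ger0_norm// Q0.
rewrite bmf_RintegralZl; last exact: bmfD.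
rewrite bmf_RintegralD// -/(n_ n).
have -> : (B1 + B2 ^+ 2) / Num.sqrt (n_ n) =
    Num.sqrt (n_ n) * (B1 / n_ n + B2 ^+ 2 / n_ n).
  rewrite -mulrDl mulrCA; congr (_ * _).
  by rewrite -[X in _ = _ / X]s2 expr2 invfM mulVKf// gt_eqF.
by rewrite ler_pM2l// lerD.
Qed.

Lemma measurable_pick_freeze_estimator N :
  measurable_fun setT (pick_freeze_estimator N).
Proof.
have bez (h : TZ * TW -> R) j l : bmf h -> bmf (fun w => h (zeta j w, W l w)).
  by move=> bh; apply: (bmf_comp bh); exact: measurable_fun_pair.
suff [] : bmf (pick_freeze_estimator N) by [].
apply: bmfM => //; apply: bmf_sum => l; apply: bmfB.
  by apply: bmfM => //; apply: bmf_sum => j; exact: bez.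
by apply: bmfX; apply: bmfM => //; apply: bmf_sum => j; exact: bez.
Qed.

Lemma pick_freeze_clt :
  cvg_in_law P (fun N w => Num.sqrt N%:R * (pick_freeze_estimator N w - theta))
    (centered_gaussian (\int[P]_w a (Z0 w) ^+ 2 + \int[P]_w b (W0 w) ^+ 2)).
Proof.
pose Y N w := Num.sqrt N%:R * (pick_freeze_estimator N w - theta).
have mY N : measurable_fun setT (Y N).
  apply: measurable_funM => //; apply: measurable_funB => //.
  exact: measurable_pick_freeze_estimator.
set v := _ + _; set mu := centered_gaussian v.
split=> // g cg [M gM].
have bg : bmf g by split; [exact: continuous_measurable_fun|exists M].
rewrite -[X in _ --> X]/(\int[mu]_x (g x)%:E)%E (bmf_integral mu bg).
have -> : (fun n => 'E_P[g \o Y n]%E) = (fun n => (\int[P]_w g (Y n w))%:E).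
  by apply/funext => n; rewrite bmf_expectation//; exact: (bmf_comp bg (mY n)).
apply: cvg_EFin; first exact: nearW.
apply: (portmanteau_lipschitz mY) cg _; last by exists M.
(* The shift to sample size [n.+1] leaves the limit unchanged and makes the inverses in the
   decomposition genuine. *)
move=> {bg gM}g B L L0 gB gL; rewrite -cvg_shiftS/=.
have [K rK] := remainder_bound.
have [Ma Ma0 aM] := bmf_bound ba; have [Mb Mb0 bM] := bmf_bound bb.
have v0 : 0 <= v.
  by apply: addr_ge0; apply: Rintegral_ge0 => w _; exact: sqr_ge0.
have := @clt_lipschitz _ T R P v (Ma + Mb) K
  (fun j w => a (zeta j w) + b (W j w)) r g B L v0 (addr_ge0 (ltW Ma0) (ltW Mb0))
  L0 gB gL.
have bxi j : bmf (fun w => a (zeta j w) + b (W j w)).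
  by apply: bmfD; exact: bmf_comp.
move=> /(_ (fun j => bmf_measurable (bxi j))).
have xiM (j : nat) w : `|a (zeta j w) + b (W j w)| <= Ma + Mb.
  by rewrite (le_trans (ler_normD _ _))// lerD.
move=> /(_ xiM (linear_part_first ba bb a_centered b_centered)).
move=> /(_ (linear_part_second ba bb a_centered)).
move=> /(_ b_r rK).
apply: cvg_trans; apply: near_eq_cvg; apply: nearW => n.
by apply: eq_Rintegral => w _; rewrite /Y -estimator_decomposition.
Qed.

End statistic.

End two_samples.

(** * Conditional probabilities *)

Lemma measurable_set_bool d (T : measurableType d) (b : T -> bool) :
  measurable_fun setT b -> measurable [set x | b x].
Proof. by move=> mb; exact: (measurable_preimageT mb (B := [set true])). Qed.

Lemma Rintegral_bool d (T : measurableType d) (R : realType)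
    (P : probability T R) (b : T -> bool) : measurable_fun setT b ->
  \int[P]_x (b x)%:R = fine (P [set x | b x]).
Proof.
move=> mb; rewrite -(Rintegral_indic_prob P (measurable_set_bool mb)).
apply: eq_Rintegral => x _; rewrite indicE; congr ((nat_of_bool _)%:R).
by apply/esym; case bx : (b x); [exact/mem_set|apply/memNset; rewrite /= bx].
Qed.

Section conditional_expectation.
Context d (T : measurableType d) (R : realType) (P : probability T R).

(* [p] is any version of the conditional probability, [psi] an explicit one; they
   agree almost everywhere. *)
Lemma conditional_probability_sqr (GG : set_system T) (A : set T)
    (p : T -> R) (psi : g_sigma_algebraType GG -> R) (x : R) :
  sigma_algebra setT GG -> GG `<=` measurable -> measurable A ->
  conditional_probability P GG A p -> bmf psi ->
  (forall C, GG C -> \int[P]_w (psi w * \1_C w) = fine (P (A `&` C))) ->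
  'E_P[fun w => ((x - p w) ^+ 2)%R]%E = (\int[P]_w (x - psi w) ^+ 2)%:E.
Proof.
move=> sGG GGm mA [mp ip Ep] bpsi Epsi.
pose TG := g_sigma_algebraType GG.
have sGGE : <<s GG>> = GG by exact: sigma_algebra_id.
(* The integrals of [p] and [psi] are compared on sets of [GG] only, so almost everywhere uniqueness
   is applied on the coarser space [TG], under the image [Q] of [P] by the identity. *)
pose J : T -> TG := id.
have mJ : measurable_fun setT J.
  by move=> _ B; rewrite /measurable/= sGGE setTI => /GGm.
pose Q : probability TG R := distribution P (mfun_Sub (mem_set mJ)).
have mpG : measurable_fun setT (p : TG -> R).
  by move=> _ B mB; rewrite /measurable/= sGGE setTI; exact: mp.
have bpsiT : bmf (psi : T -> R) by exact: (bmf_comp bpsi mJ).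
have iQ : Q.-integrable setT (EFin \o p).
  apply: (integrable_pushforward mJ) => //.
  exact/measurable_EFinP.
have aeQ : ae_eq Q setT (EFin \o p) (EFin \o psi).
  apply: integral_ae_eq => //.
    by apply/measurable_EFinP; exact: bmf_measurable.
  move=> C _ mC; have GC : GG C by move: mC; rewrite /measurable/= sGGE.
  transitivity (\int[P]_(w in C) (p w)%:E)%E.
    apply: (integral_pushforward mJ) => //; first exact/measurable_EFinP.
    by apply: (integrableS measurableT) => //; exact: GGm.
  rewrite Ep//; transitivity (\int[P]_(w in C) (psi w)%:E)%E; last first.
    apply/esym; apply: (integral_pushforward mJ) => //.
      by apply/measurable_EFinP; exact: bmf_measurable.
    apply: (integrableS measurableT) => //; first exact: GGm.
    exact: (bmf_integrable P bpsiT).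
  rewrite -[LHS]fineK ?fin_num_measure//; last first.
    by apply: measurableI => //; exact: GGm.
  rewrite -Epsi// integral_mkcond -bmf_integral; last first.
    by apply: bmfM => //; apply: bmf_indic; exact: GGm.
  by apply: eq_integral => w _; rewrite epatch_indic/= EFinM.
have m2 (h : TG -> R) : measurable_fun setT h ->
    measurable_fun setT (fun w : TG => ((x - h w) ^+ 2)%:E).
  move=> mh; apply/measurable_EFinP; apply: measurable_funX.
  exact: measurable_funB.
rewrite unlock.
transitivity (\int[Q]_w ((x - p w) ^+ 2)%:E)%E.
  apply/esym; apply: (ge0_integral_pushforward mJ P measurableT (m2 _ mpG)).
  by move=> w _; rewrite lee_fin sqr_ge0.
transitivity (\int[Q]_w ((x - psi w) ^+ 2)%:E)%E.
  apply: ae_eq_integral => //.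
  - exact: m2.
  - by apply: m2; exact: bmf_measurable.
  - by apply: filterS aeQ => w /= H _; have [->] := H Logic.I.
rewrite -bmf_integral; last by apply: bmfX; exact: bmfB.
apply: (ge0_integral_pushforward mJ P measurableT (m2 _ (bmf_measurable bpsi))).
by move=> w _; rewrite lee_fin sqr_ge0.
Qed.

End conditional_expectation.

(** * The pick-freeze identity *)

Section mixing.
Context (d : nat) (dE : 'I_d -> measure_display)
  (E : forall i : 'I_d, measurableType (dE i)).

(** Coordinate [v] is read at [p.1] and the others at [p.2]. On the diagonal this gives back the
    inputs, plain or frozen; off it, [X v] and the other inputs can be integrated separately. *)
Definition mix (T1 T2 : Type) (v : 'I_d) (x : forall i, T1 -> E i)
    (y : forall i, T2 -> E i) (p : T1 * T2) : prod_space E :=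
  fun i => if i == v then x i p.1 else y i p.2.

Lemma measurable_prod_space d' (T : measurableType d') (g : T -> prod_space E) :
  (forall i, measurable_fun setT (fun w => g w i)) -> measurable_fun setT g.
Proof.
move=> mg.
refine (@measurability _ _ T (prod_space E) setT g (cylinders E) erefl _).
move=> _ [_ [i _ [B mB <-]] <-]; rewrite !setTI.
have -> : g @^-1` ((fun x : forall i, E i => x i) @^-1` B) =
  (fun w => g w i) @^-1` B by [].
exact: measurable_preimageT.
Qed.

Lemma measurable_mix d1 d2 (T1 : measurableType d1) (T2 : measurableType d2) v
    (x : forall i, T1 -> E i) (y : forall i, T2 -> E i) :
  measurable_fun setT (x v) -> (forall i, i != v -> measurable_fun setT (y i)) ->
  measurable_fun setT (mix v x y).
Proof.
move=> mx my; apply: measurable_prod_space => i; rewrite /mix.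
have [->|iv] := eqVneq i v; first exact: (measurableT_comp mx).
exact: (measurableT_comp (my i iv)).
Qed.

Lemma prod_space_law d1 d2 (T1 : measurableType d1) (T2 : measurableType d2)
    (R : realType) (P : probability T1 R) (Q : probability T2 R)
    (g : T1 -> prod_space E) (h : T2 -> prod_space E) :
  measurable_fun setT g -> measurable_fun setT h ->
  (forall B : forall i, set (E i), (forall i, measurable (B i)) ->
    P [set w | forall i, B i (g w i)] = Q [set w | forall i, B i (h w i)]) ->
  forall A, measurable A -> P (g @^-1` A) = Q (h @^-1` A).
Proof.
move=> mg mh gh.
pose G : set_system (prod_space E) := [set C | exists B : forall i, set (E i),
  (forall i, measurable (B i)) /\ C = [set x | forall i, B i (x i)]].
pose P' : probability _ _ := distribution P (mfun_Sub (mem_set mg)).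
pose Q' : probability _ _ := distribution Q (mfun_Sub (mem_set mh)).
have cylG C : cylinders E C -> G C.
  move=> [i _ [B mB <-]]; rewrite setTI.
  (* The cylinder as a box: side [B] at [i], transported along [i = j] because the factors have
     different types, and [setT] elsewhere. *)
  exists (fun j => match pselect (i = j) with
    left e => ecast j (set (E j)) e B | right _ => setT end).
  split.
    by move=> j; case: pselect => // e; case: j / e.
  apply/seteqP; split=> [x /= Bx j|x /= /(_ i)].
    by case: pselect => // e; case: j / e.
  by case: pselect => // e; rewrite (eq_axiomK e).
have coord i (B : set (E i)) : measurable B ->
    measurable [set x : prod_space E | B (x i)].
  move=> mB; apply: sub_sigma_algebra; exists i => //; exists B => //.
  by rewrite setTI.
have Gm : G `<=` measurable.
  move=> _ [B [mB ->]].
  have -> : [set x : prod_space E | forall i, B i (x i)] =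
      \bigcap_(i in [set: 'I_d]) [set x : prod_space E | B i (x i)].
    by apply/seteqP; split=> x /= H i; [move=> _|]; exact: H.
  by apply: fin_bigcap_measurable => // i _; exact: coord.
move=> A mA.
apply: (@measure_unique _ _ (prod_space E) G (fun=> setT) _ _ _ _ P' Q') => //.
- apply/seteqP; split => [C|].
    apply: smallest_sub; first exact: smallest_sigma_algebra.
    by move=> D /cylG GD; exact: sub_sigma_algebra.
  apply: smallest_sub; [exact: sigma_algebra_measurable|exact: Gm].
- move=> _ _ [B [mB ->]] [B' [mB' ->]].
  exists (fun i => B i `&` B' i); split; first by move=> i; exact: measurableI.
  by apply/seteqP; split=> x /=; [move=> [h1 h2] i|move=> H; split=> i; have [] := H i].
- by move=> _; exists (fun=> setT); split => //; apply/seteqP; split.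
- by rewrite bigcup_const.
- by move=> _ [B [mB ->]]; exact: gh.
- by move=> _; rewrite (le_lt_trans (probability_le1 P' measurableT)) ?ltry.
Qed.

End mixing.

Section pick_freeze_model.
Context (d : nat) (dE : 'I_d -> measure_display)
  (E : forall i : 'I_d, measurableType (dE i)) (dO : measure_display)
  (Omega : measurableType dO) (R : realType) (P : probability Omega R)
  (X X' : forall i : 'I_d, {RV P >-> E i}) (v : 'I_d).

Let FF (s : 'I_d + 'I_d) : set_system Omega := match s with
  | inl i => g_sigma_algebra_preimage (X i)
  | inr i => g_sigma_algebra_preimage (X' i)
  end.

Hypotheses (X'_copy : forall i, i != v -> same_law P (X' i) (X i))
  (XX'_indep : independent P [set s : 'I_d + 'I_d | s <> inr v] FF).

Let mX i : measurable_fun setT (X i : Omega -> E i).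
Proof. exact: measurable_funP. Qed.

Let sFF s : sigma_algebra setT (FF s).
Proof. by case: s => i; exact: sigma_algebra_g_preimage. Qed.

Let mFF s : FF s `<=` measurable.
Proof. by case: s => i; exact: g_sigma_algebra_preimage_measurable. Qed.

Let sub (J : set ('I_d + 'I_d)) : set_system Omega := \bigcup_(s in J) FF s.

Let sub_measurable J : sub J `<=` measurable.
Proof. by move=> A [s _]; exact: mFF. Qed.

Let msubX J i : J (inl i) ->
  measurable_fun setT (X i : g_sigma_algebraType (sub J) -> E i).
Proof.
by move=> Ji _ B mB; apply: sub_sigma_algebra; exists (inl i) => //; exists B.
Qed.

Let msubX' J i : J (inr i) ->
  measurable_fun setT (X' i : g_sigma_algebraType (sub J) -> E i).
Proof.
by move=> Ji _ B mB; apply: sub_sigma_algebra; exists (inr i) => //; exists B.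
Qed.

Let mid J : measurable_fun setT (id : Omega -> g_sigma_algebraType (sub J)).
Proof.
by move=> _ B mB; rewrite setTI; exact: (sub_gen_measurable (@sub_measurable J)).
Qed.

(** The identity map into the two coarser spaces plays the role of the independent variables: [H]
    depends on each argument only through a block of inputs, so the diagonal can be separated. *)
Lemma block_Rintegral (J1 J2 : set ('I_d + 'I_d))
    (H : g_sigma_algebraType (sub J1) * g_sigma_algebraType (sub J2) -> R) :
  J1 `<=` [set s | s <> inr v] -> J2 `<=` [set s | s <> inr v] ->
  J1 `&` J2 = set0 -> bmf H ->
  \int[P]_w H (w, w) = \int[P]_w \int[P]_w' H (w, w').
Proof.
move=> J1v J2v J12 bH.
apply: (@indep_Rintegral _ _ _ Omega (g_sigma_algebraType (sub J1))
  (g_sigma_algebraType (sub J2)) R P id id H) => //.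
move=> _ _ [A mA <-] [B mB <-]; rewrite !setTI.
exact: (independent_blocks sFF mFF XX'_indep J1v J2v J12).
Qed.

Let prob_bigcap (Y : forall i : 'I_d, {RV P >-> E i}) (inj : 'I_d -> 'I_d + 'I_d)
    (B : forall i, set (E i)) : injective inj ->
  (forall i, i != v -> inj i <> inr v) ->
  (forall i, i != v -> FF (inj i) = g_sigma_algebra_preimage (Y i)) ->
  (forall i, measurable (B i)) ->
  P [set w | forall i, i != v -> B i (Y i w)] =
    (\prod_(i | i != v) fine (P (Y i @^-1` B i)))%:E.
Proof.
move=> inj_inj injv FFE mB.
pose s := [seq inj i | i <- enum 'I_d & i != v].
pose K : {fset 'I_d + 'I_d} := seq_fset tt s.
have us : uniq s by rewrite map_inj_uniq// filter_uniq// enum_uniq.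
have Ks : perm_eq K s by apply: uniq_perm => // z; rewrite seq_fsetE.
have KP z : z \in K -> exists2 i, i != v & z = inj i.
  rewrite seq_fsetE => /mapP[i]; rewrite mem_filter => /andP[iv _] ->.
  by exists i.
have inK i : i != v -> inj i \in K.
  by move=> iv; rewrite seq_fsetE map_f// mem_filter iv mem_enum.
(* Off the image of the indices other than [v] the condition is vacuous; at [inj i], injectivity
   leaves the single condition on [Y i]. The same argument thus covers [X] and [X']. *)
pose A (z : 'I_d + 'I_d) : set Omega :=
  [set w | forall i, i != v -> z = inj i -> B i (Y i w)].
have AE i : i != v -> A (inj i) = Y i @^-1` B i.
  move=> iv; apply/seteqP; split=> [w /(_ i iv erefl)//|w Bw j jv /inj_inj ij].
  by rewrite -ij.
have KD : [set` K] `<=` [set s | s <> inr v].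
  by move=> z /= /KP[i iv ->]; exact: injv.
have FA z : z \in K -> FF z (A z).
  move=> /KP[i iv ->]; rewrite AE// FFE//.
  by exists (B i) => //; rewrite setTI.
rewrite (_ : [set w | _] = \bigcap_(i in [set` K]) A i); last first.
  apply/seteqP; split=> [w Bw z /= _ i iv _|w Aw i iv]; first exact: Bw.
  exact: (Aw (inj i) (inK i iv) i iv erefl).
rewrite (XX'_indep KD FA); congr (_%:E); rewrite (perm_big s Ks)/= big_map big_filter.
rewrite big_enum_cond/=; apply: eq_bigr => i iv.
by rewrite AE.
Qed.

(** Equal marginals and mutual independence give equal probabilities to boxes. Freezing coordinate
    [v] at [x v] keeps both laws on [prod_space E] instead of a product over the other indices; the
    [unit] argument is a dummy. *)
Lemma copy_law (x : forall i, E i) (B : set (prod_space E)) : measurable B ->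
  P [set w | B (mix v (fun i (_ : unit) => x i) (fun i => X' i) (tt, w))] =
  P [set w | B (mix v (fun i (_ : unit) => x i) (fun i => X i) (tt, w))].
Proof.
move=> mB.
have mm (Y : forall i : 'I_d, {RV P >-> E i}) : measurable_fun setT
    (fun w => mix v (fun i (_ : unit) => x i) (fun i => Y i) (tt, w)).
  apply: measurable_prod_space => i; rewrite /mix.
  by case: (i == v); [exact: measurable_cst|exact: measurable_funP].
apply: (prod_space_law (mm X') (mm X)) mB => C mC.
have E1 (Y : forall i : 'I_d, {RV P >-> E i}) :
    [set w | forall i, C i (mix v (fun i (_ : unit) => x i) (fun i => Y i) (tt, w) i)] =
    [set w | C v (x v)] `&` [set w | forall i, i != v -> C i (Y i w)].
  apply/seteqP; split=> w /=.
    move=> H; split=> [|i iv]; first by have := H v; rewrite /mix eqxx.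
    by have := H i; rewrite /mix (negbTE iv).
  by move=> [Cv H] i; rewrite /mix; case: eqVneq => [->|/H].
rewrite !E1; have [Cv|nCv] := pselect (C v (x v)); last first.
  rewrite (_ : [set w | C v (x v)] = set0) ?set0I//.
  by apply/seteqP; split.
rewrite (_ : [set w | C v (x v)] = setT); last by apply/seteqP; split.
rewrite !setTI (@prob_bigcap X' inr)//; last 2 first.
- by move=> i j [].
- by move=> i iv [] /eqP; rewrite (negbTE iv).
rewrite (@prob_bigcap X inl)//; last by move=> i j [].
congr (_%:E); apply: eq_bigr => i iv; congr fine.
exact: X'_copy.
Qed.

Let GG : set_system Omega := g_sigma_algebra_preimage (X v).

Lemma joint_mix w : joint X w = mix v (fun i => X i) (fun i => X i) (w, w).
Proof. by apply: functional_extensionality_dep => i; rewrite /joint /mix; case: ifP. Qed.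

Lemma joint_freeze_mix w :
  joint (freeze v X X') w = mix v (fun i => X i) (fun i => X' i) (w, w).
Proof.
by apply: functional_extensionality_dep => i; rewrite /joint /mix /freeze; case: ifP.
Qed.

Section test_function.
Context (h : prod_space E -> R).
Hypothesis bh : bmf h.

(** By independence of the inputs, averaging over those other than [X v] gives an explicit version
    of the conditional expectation of [h (joint X)] given [X v]. *)
Let psi (w : Omega) : R :=
  \int[P]_w' h (mix v (fun i => X i) (fun i => X i) (w, w')).

Let mmix d1 d2 (T1 : measurableType d1) (T2 : measurableType d2)
    (x : forall i, T1 -> E i) (y : forall i, T2 -> E i) w :
  measurable_fun setT (x v) -> (forall i, i != v -> measurable_fun setT (y i)) ->
  measurable_fun setT (fun w' => mix v x y (w, w')).
Proof.
move=> mx my; apply: (measurableT_comp (measurable_mix mx my)).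
exact: measurable_fun_pair.
Qed.

Let bmix1 (Y : forall i : 'I_d, {RV P >-> E i}) w :
  bmf (fun w' => h (mix v (fun i => X i) (fun i => Y i) (w, w'))).
Proof.
by apply: (bmf_comp bh); apply: (mmix (T1 := Omega)).
Qed.

Let psi_copy w :
  \int[P]_w' h (mix v (fun i => X i) (fun i => X' i) (w, w')) = psi w.
Proof.
have mm (Y : forall i : 'I_d, {RV P >-> E i}) : measurable_fun setT
    (fun w' => mix v (fun i => X i) (fun i => Y i) (w, w')).
  by apply: (mmix (T1 := Omega)) => // i _; exact: measurable_funP.
apply: (Rintegral_law (mm X') (mm X) _ bh) => B mB.
exact: (copy_law (fun i => X i w) mB).
Qed.

Let bpsi : bmf (psi : g_sigma_algebraType GG -> R).
Proof.
apply: (@bmf_Rintegralr _ _ (g_sigma_algebraType GG) Omega R P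
  (fun z => h (mix v (fun i => X i) (fun i => X i) z))).
apply: (bmf_comp bh); apply: measurable_mix => // _ B mB.
by apply: sub_sigma_algebra; exists B.
Qed.

Let mid_GG : measurable_fun setT (id : Omega -> g_sigma_algebraType GG).
Proof.
have GGm : GG `<=` measurable by exact: g_sigma_algebra_preimage_measurable.
by move=> _ B mB; rewrite setTI; exact: (sub_gen_measurable GGm).
Qed.

Let bpsiO : bmf (psi : Omega -> R).
Proof. exact: (bmf_comp bpsi mid_GG). Qed.

(** The defining property of the conditional expectation, tested on functions of [X v]: the blocks
    [X v] and the remaining [X i] are independent. *)
Lemma pick_freeze_cond (Phi : g_sigma_algebraType GG -> R) : bmf Phi ->
  \int[P]_w (h (joint X w) * Phi w) = \int[P]_w (psi w * Phi w).
Proof.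
move=> bPhi.
pose J1 : set ('I_d + 'I_d) := [set inl v].
pose J2 : set ('I_d + 'I_d) := [set s | exists2 i, i != v & s = inl i].
pose H (z : g_sigma_algebraType (sub J1) * g_sigma_algebraType (sub J2)) :=
  h (mix v (fun i => X i) (fun i => X i) z) * Phi z.1.
have midJ : measurable_fun setT
    (id : g_sigma_algebraType (sub J1) -> g_sigma_algebraType GG).
  have GGJ : <<s GG>> `<=` <<s sub J1>>.
    apply: smallest_sub; first exact: smallest_sigma_algebra.
    by move=> C GC; apply: sub_sigma_algebra; exists (inl v).
  by move=> _ B mB; rewrite setTI; exact: GGJ.
have bH : bmf H.
  apply: bmfM.
    apply: (bmf_comp bh); apply: measurable_mix; first exact: msubX.
    by move=> i iv; apply: msubX; exists i.
  exact: (bmf_comp bPhi (measurableT_comp midJ _)).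
under eq_Rintegral do rewrite joint_mix.
have /= -> := @block_Rintegral J1 J2 H _ _ _ bH.
- by apply: eq_Rintegral => w _; rewrite /H/= (bmf_RintegralZr _ _ (bmix1 X w)).
- by move=> z ->.
- by move=> z [i _ ->].
- by apply/seteqP; split=> z //= [-> [i /eqP iv [vi]]]; apply: iv.
Qed.

Lemma pick_freeze_product (g : prod_space E -> R) : bmf g ->
  \int[P]_w (g (joint X w) * h (joint (freeze v X X') w)) =
  \int[P]_w (g (joint X w) * psi w).
Proof.
move=> bg.
pose J1 : set ('I_d + 'I_d) := [set s | exists i, s = inl i].
pose J2 : set ('I_d + 'I_d) := [set s | exists2 i, i != v & s = inr i].
pose H (z : g_sigma_algebraType (sub J1) * g_sigma_algebraType (sub J2)) :=
  g (joint X z.1) * h (mix v (fun i => X i) (fun i => X' i) z).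
have bH : bmf H.
  apply: bmfM.
    apply: (bmf_comp bg); apply: measurableT_comp => //.
    by apply: measurable_prod_space => i; apply: msubX; exists i.
  apply: (bmf_comp bh); apply: measurable_mix; first by apply: msubX; exists v.
  by move=> i iv; apply: msubX'; exists i.
under eq_Rintegral do rewrite joint_freeze_mix.
have /= -> := @block_Rintegral J1 J2 H _ _ _ bH.
- apply: eq_Rintegral => w _; rewrite /H/= (bmf_RintegralZl _ _ (bmix1 X' w)).
  by rewrite psi_copy.
- by move=> z [i ->].
- by move=> z [i /eqP iv ->] [].
- by apply/seteqP; split=> z //= [[i ->] [j _]].
Qed.

Lemma freeze_mean :
  \int[P]_w h (joint (freeze v X X') w) = \int[P]_w h (joint X w).
Proof.
have := pick_freeze_product (bmf_cst _ 1).
under eq_Rintegral do rewrite mul1r.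
under [in X in _ = X]eq_Rintegral do rewrite mul1r.
move=> ->; have := pick_freeze_cond (bmf_cst _ 1).
under eq_Rintegral do rewrite mulr1.
by under [in X in _ = X]eq_Rintegral do rewrite mulr1.
Qed.

End test_function.

Lemma pick_freeze_variance (b : prod_space E -> bool) (p : Omega -> R) :
  measurable_fun setT b ->
  conditional_probability P GG [set w | b (joint X w)] p ->
  'E_P[fun w => ((\int[P]_w' (b (joint X w'))%:R - p w) ^+ 2)%R]%E =
  (\int[P]_w ((b (joint X w))%:R * (b (joint (freeze v X X') w))%:R)
   - (\int[P]_w (b (joint X w))%:R) ^+ 2)%:E.
Proof.
move=> mb cp; set F := \int[P]_w' (b (joint X w'))%:R.
have bb : bmf (fun x => (b x)%:R : R) by exact: bmf_bool.
have mA : measurable [set w | b (joint X w)].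
  apply: measurable_set_bool.
  by apply: (measurableT_comp mb); exact: measurable_joint.
pose psi (w : Omega) : R :=
  \int[P]_w' (b (mix v (fun i => X i) (fun i => X i) (w, w')))%:R.
have bpsi : bmf (psi : g_sigma_algebraType GG -> R).
  apply: (@bmf_Rintegralr _ _ (g_sigma_algebraType GG) Omega R P
    (fun z => (b (mix v (fun i => X i) (fun i => X i) z))%:R)).
  apply: (bmf_comp bb); apply: measurable_mix => // _ B mB.
  by apply: sub_sigma_algebra; exists B.
have GGm : GG `<=` measurable by exact: g_sigma_algebra_preimage_measurable.
have mid_GG : measurable_fun setT (id : Omega -> g_sigma_algebraType GG).
  by move=> _ B mB; rewrite setTI; exact: (sub_gen_measurable GGm).
have bpsiO : bmf (psi : Omega -> R) by exact: (bmf_comp bpsi mid_GG).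
have cond := pick_freeze_cond bb.
rewrite (conditional_probability_sqr F _ GGm mA cp bpsi).
- congr (_%:E).
  have E1 : \int[P]_w psi w = F.
    have := cond _ (bmf_cst _ 1).
    under eq_Rintegral do rewrite mulr1.
    by under [in X in _ = X]eq_Rintegral do rewrite mulr1.
  have E2 : \int[P]_w ((b (joint X w))%:R * (b (joint (freeze v X X') w))%:R) =
      \int[P]_w psi w ^+ 2.
    by rewrite (pick_freeze_product bb bb) (cond _ bpsi).
  rewrite E2.
  have bp2 : bmf (fun w => psi w ^+ 2) by exact: bmfX.
  have bFp : bmf (fun w => 2 * F * psi w) by apply: bmfM.
  transitivity (\int[P]_w (F ^+ 2 - 2 * F * psi w + psi w ^+ 2)).
    by apply: eq_Rintegral => w _; ring.
  rewrite bmf_RintegralD//; last exact: bmfB.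
  rewrite (bmf_RintegralB P (bmf_cst _ (F ^+ 2)) bFp) (bmf_RintegralZl P (2 * F) bpsiO).
  rewrite prob_Rintegral_cst E1.
  by ring.
- exact: sigma_algebra_g_preimage.
- move=> C GC.
  have bC : bmf (\1_C : g_sigma_algebraType GG -> R).
    by apply: bmf_indic; exact: sub_sigma_algebra.
  rewrite -(cond _ bC) -Rintegral_indic_prob; last first.
    by apply: measurableI => //; exact: GGm.
  apply: eq_Rintegral => w _; rewrite indicI/=; congr (_ * _).
  rewrite indicE; congr ((nat_of_bool _)%:R).
  case bw : (b (joint X w)); apply/esym; first exact/mem_set.
  by apply/memNset; rewrite /= bw.
Qed.

End pick_freeze_model.

(** * Identification of the limit and of the variances *)

Lemma measurable_vle d (T : measurableType d) (R : realType) (k : nat)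
    (f g : T -> k.-tuple R) : measurable_fun setT f -> measurable_fun setT g ->
  measurable_fun setT (fun x => vle (f x) (g x)).
Proof.
move=> mf mg; apply: (@measurable_fun_bool _ _ _ _ true); rewrite setTI.
have -> : (fun x => vle (f x) (g x)) @^-1` [set true] =
    \bigcap_(i in [set: 'I_k])
      ((fun x => tnth (f x) i <= tnth (g x) i) @^-1` [set true]).
  apply/seteqP; split=> [z /forallP H i _|z H]; first exact: H.
  by apply/forallP => i; exact: (H i Logic.I).
apply: fin_bigcap_measurable => // i _.
apply: measurable_preimageT => //; apply: measurable_fun_ler.
  exact: (measurableT_comp (measurable_tnth i) mf).
exact: (measurableT_comp (measurable_tnth i) mg).
Qed.

Lemma bmf_variance d (T : measurableType d) (R : realType) (P : probability T R)
    (f : T -> R) : bmf f ->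
  ('V_P[f] = (\int[P]_w (f w - \int[P]_w' f w') ^+ 2)%:E)%E.
Proof.
move=> bf; rewrite /variance unlock (bmf_expectation P bf)/=.
rewrite -(bmf_expectation P (bmfX 2 (bmfB bf (bmf_cst _ _)))).
by congr ('E_P[_])%E; apply/funext => w; rewrite /= expr2.
Qed.

Lemma CVM_estimatorE (R : realType) (k : nat) d (T : measurableType d)
  (Z1 Z2 W : nat -> T -> k.-tuple R) (e s : (k.-tuple R * k.-tuple R) * k.-tuple R -> R) :
  (forall z, e z = (vle z.1.1 z.2)%:R * (vle z.1.2 z.2)%:R) ->
  (forall z, s z = 2^-1 * ((vle z.1.1 z.2)%:R + (vle z.1.2 z.2)%:R)) ->
  forall N w, CVM_estimator Z1 Z2 W N w =
   pick_freeze_estimator (fun j w => (Z1 j w, Z2 j w)) W e s N w.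
Proof.
move=> eE sE N w; congr (_ * _); apply: eq_bigr => l _; congr (_ * _ - _ ^+ 2).
  by apply: eq_bigr => j _; rewrite eE.
rewrite invfM mulrAC mulrC; congr (_ * _); rewrite mulr_sumr.
by apply: eq_bigr => j _; rewrite sE.
Qed.

Theorem theorem3p5 (R : realType) (dO : measure_display)
    (Omega : measurableType dO) (P : probability Omega R)
    (d k : nat) (dE : 'I_d -> measure_display)
    (E : forall i : 'I_d, measurableType (dE i))
    (f : {mfun prod_space E >-> k.-tuple R})
    (X X' : forall i : 'I_d, {RV P >-> E i}) (v : 'I_d)
    (X'_copy : forall i, i != v -> same_law P (X' i) (X i))
    (XX'_indep : independent P [set s : 'I_d + 'I_d | s <> inr v]
      (fun s => match s with
                | inl i => g_sigma_algebra_preimage (X i)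
                | inr i => g_sigma_algebra_preimage (X' i)
                end))
    (Fv : k.-tuple R -> Omega -> R)
    (W : {RV P >-> k.-tuple R})
    (Z1s Z2s Ws : nat -> {RV P >-> k.-tuple R}) :
  let Z := output f X in
  let Zv1 := Z in
  let Zv2 := output f (freeze v X X') in
  let PF := fun w => (Zv1 w, Zv2 w) in
  let PFs := fun j w => (Z1s j w, Z2s j w) in
  (forall t, conditional_probability P (g_sigma_algebra_preimage (X v))
     [set w | vle (Z w) t] (Fv t)) ->
  same_law P W Z ->
  independent2 P (g_sigma_algebra_preimage W) (g_sigma_algebra_preimage PF) ->
  (forall j, same_law P (PFs j) PF) ->
  independent P [set: nat] (fun j => g_sigma_algebra_preimage (PFs j)) ->
  (forall l, same_law P (Ws l) Z) ->
  independent P [set: nat] (fun l => g_sigma_algebra_preimage (Ws l)) ->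
  independent2 P (sigma_seq PFs) (sigma_seq Ws) ->
  let F := mcdf P Z in
  let G := fun t => fine (P [set w | vle (Zv1 w) t /\ vle (Zv2 w) t]) in
  let dF : probability (k.-tuple R) R := distribution P Z in
  let N2 := fine (\int[dF]_t 'E_P[fun w => ((F t - Fv t w) ^+ 2)%R])%E in
  let U := fun w => G (W w) - F (W w) ^+ 2 in
  let V := fun w => \int[dF]_t
    ((vle (Zv1 w) t)%:R * (vle (Zv2 w) t)%:R
     - ((vle (Zv1 w) t)%:R + (vle (Zv2 w) t)%:R) * F t) in
  cvg_in_law P
    (fun N w => Num.sqrt N%:R * (CVM_estimator Z1s Z2s Ws N w - N2))
    (centered_gaussian (fine ('V_P[U] + 'V_P[V])%E)).
Proof.
move=> Z Zv1 Zv2 PF PFs cFv lW iWPF lPFs iPFs lWs iWs iPW F G dF N2 U V.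
have mW : measurable_fun setT W by exact: measurable_funP.
have mPF : measurable_fun setT PF by exact: measurable_fun_pair.
have mPFs j : measurable_fun setT (PFs j) by apply: measurable_fun_pair.
have mWs l : measurable_fun setT (Ws l) by exact: measurable_funP.
have mv1 : measurable_fun setT
    (fun z : (k.-tuple R * k.-tuple R) * k.-tuple R => vle z.1.1 z.2).
  by apply: measurable_vle => //; exact: (measurableT_comp measurable_fst).
have mv2 : measurable_fun setT
    (fun z : (k.-tuple R * k.-tuple R) * k.-tuple R => vle z.1.2 z.2).
  by apply: measurable_vle => //; exact: (measurableT_comp measurable_snd).
have bv1 := bmf_bool R mv1; have bv2 := bmf_bool R mv2.
pose e (z : (k.-tuple R * k.-tuple R) * k.-tuple R) : R :=
  (vle z.1.1 z.2)%:R * (vle z.1.2 z.2)%:R.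
pose s (z : (k.-tuple R * k.-tuple R) * k.-tuple R) : R :=
  2^-1 * ((vle z.1.1 z.2)%:R + (vle z.1.2 z.2)%:R).
have be : bmf e by exact: bmfM.
have bs : bmf s by apply: bmfM => //; exact: bmfD.
have lWsW l : same_law P (Ws l) W by move=> B mB; rewrite lWs// lW.
(* With [PF] and [W] as reference variables, the two projections in the limit variance become the
   centered versions of [V] and [U]. *)
have clt := @pick_freeze_clt _ _ _ Omega _ _ R P PFs Ws PF W mPFs mWs mPF mW
  lPFs lWsW iPFs iWs iPW e s be bs.
have mvt t : measurable_fun setT (fun x => vle (f x) t).
  by apply: measurable_vle => //; exact: measurable_funP.
have bvt t := bmf_bool R (mvt t).
have mjoint (Y : forall i : 'I_d, {RV P >-> E i}) t :
    measurable_fun setT (fun w => vle (f (joint Y w)) t).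
  exact: (measurableT_comp (mvt t) (measurable_joint Y)).
have FE t : \int[P]_w (vle (Z w) t)%:R = F t by exact: Rintegral_bool (mjoint X t).
(* Plain and frozen outputs have the same distribution function, so the factor [2^-1] in [s] makes
   its mean exactly [F]. *)
have F'E t : \int[P]_w s (PF w, t) = F t.
  have b1 := bmf_bool R (mjoint X t).
  have b2 := bmf_bool R (mjoint (freeze v X X') t).
  rewrite /s/= (bmf_RintegralZl P _ (bmfD b1 b2)) (bmf_RintegralD P b1 b2).
  have := freeze_mean X'_copy XX'_indep (bvt t) => /= ->.
  by rewrite -[F t]FE; field.
have G'E t : \int[P]_w e (PF w, t) = G t.
  have mG := measurable_and (mjoint X t) (mjoint (freeze v X X') t).
  transitivity (\int[P]_w (vle (Zv1 w) t && vle (Zv2 w) t)%:R).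
    by apply: eq_Rintegral => w _; rewrite /e/= -natrM mulnb.
  rewrite (Rintegral_bool P mG); congr (fine (P _)).
  by apply/seteqP; split=> w /= /andP.
have bF : bmf F.
  rewrite (_ : F = fun t => \int[P]_w s (PF w, t)); last by apply/funext => t; rewrite F'E.
  apply: (@bmf_Rintegralr _ _ _ _ R P (fun z => s (PF z.2, z.1))).
  apply: (bmf_comp bs); apply: measurable_fun_pair => //.
  exact: measurableT_comp.
have bG : bmf G.
  rewrite (_ : G = fun t => \int[P]_w e (PF w, t)); last by apply/funext => t; rewrite G'E.
  apply: (@bmf_Rintegralr _ _ _ _ R P (fun z => e (PF z.2, z.1))).
  apply: (bmf_comp be); apply: measurable_fun_pair => //.
  exact: measurableT_comp.
have bU : bmf U by apply: (bmf_comp _ mW (h := fun t => G t - F t ^+ 2)); apply: bmfB => //; exact: bmfX.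
have lawW B : measurable B -> dF (id @^-1` B) = P (W @^-1` B).
  by move=> mB; rewrite lW.
have dFE (h : k.-tuple R -> R) : bmf h -> \int[dF]_t h t = \int[P]_w h (W w).
  by move=> bh; exact: (@Rintegral_law _ _ _ (k.-tuple R) Omega (k.-tuple R) R dF P id W h
    (@measurable_id _ _ _) mW lawW bh).
have bh : bmf (fun t => G t - F t ^+ 2) by apply: bmfB => //; exact: bmfX.
have bF2 : bmf (fun w => F (W w) ^+ 2) by apply: bmfX; exact: (bmf_comp bF mW).
have N2E : N2 = \int[P]_w U w.
  rewrite /N2 -(dFE _ bh).
  congr fine; apply: eq_integral => t _.
  have := pick_freeze_variance X'_copy XX'_indep (mvt t) (cFv t).
  by rewrite -G'E -FE => <-.
(* As [2 * s] is the sum of the two indicators, this is the integrand of [V]. It differs from the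
   first-order part [e - G - 2 * F * (s - F)] by [G - 2 * F ^+ 2], a function of the evaluation
   point alone whose mean is that of [V]; hence the projection on the pair is [V] minus its mean. *)
pose kap (z : (k.-tuple R * k.-tuple R) * k.-tuple R) : R := e z - 2 * s z * F z.2.
have bkap : bmf kap.
  by apply: bmfB => //; apply: bmfM; [exact: bmfM|exact: (bmf_comp bF)].
have VE w : V w = \int[P]_w' kap (PF w, W w').
  rewrite -(dFE (fun t => kap (PF w, t)) (bmf_pairr bkap (PF w))).
  by apply: eq_Rintegral => t _; rewrite /kap /e /s/= mulrA divff// mul1r.
have bkPW : bmf (fun z : Omega * Omega => kap (PF z.1, W z.2)).
  apply: (bmf_comp bkap); apply: measurable_fun_pair.
    exact: measurableT_comp.
  exact: measurableT_comp.
have bV : bmf V.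
  rewrite (_ : V = fun w => \int[P]_w' kap (PF w, W w')); last exact/funext.
  exact: (bmf_Rintegralr P bkPW).
have EV : \int[P]_w V w = \int[P]_w (G (W w) - 2 * F (W w) ^+ 2).
  transitivity (\int[P]_w' \int[P]_w kap (PF w, W w')).
    have := bmf_fubini1 P P bkPW; rewrite (bmf_fubini2 P P bkPW) => ->.
    by apply: eq_Rintegral => w _; rewrite VE.
  apply: eq_Rintegral => w _.
  have be' : bmf (fun w' => e (PF w', W w)).
    by apply: (bmf_comp be); exact: measurable_fun_pair.
  have bs' : bmf (fun w' => s (PF w', W w)).
    by apply: (bmf_comp bs); exact: measurable_fun_pair.
  have bsF : bmf (fun w' => 2 * F (W w) * s (PF w', W w)) by exact: bmfM.
  transitivity (\int[P]_w' (e (PF w', W w) - 2 * F (W w) * s (PF w', W w))).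
    by apply: eq_Rintegral => w' _; rewrite /kap/=; ring.
  rewrite (bmf_RintegralB P be' bsF) (bmf_RintegralZl P _ bs') G'E F'E.
  by ring.
have aE w : \int[P]_w' (e (PF w, W w') - G (W w') -
    2 * F (W w') * (s (PF w, W w') - F (W w'))) = V w - \int[P]_w V w.
  have bGF : bmf (fun w' => G (W w') - 2 * F (W w') ^+ 2).
    by apply: bmfB; [exact: (bmf_comp bG mW)|exact: bmfM].
  rewrite EV VE -(bmf_RintegralB P (bmf_pairr bkPW w) bGF).
  by apply: eq_Rintegral => w' _; rewrite /kap/=; ring.
rewrite (bmf_variance P bU) (bmf_variance P bV) addrC -EFinD/= N2E.
rewrite (_ : (fun N w => _) = fun N w =>
    Num.sqrt N%:R * (pick_freeze_estimator PFs Ws e s N w - \int[P]_w U w)); last first.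
  by apply/funext => N; apply/funext => w; rewrite -(CVM_estimatorE Z1s Z2s Ws).
have thetaE : \int[P]_w (\int[P]_w' e (PF w', W w) -
    (\int[P]_w' s (PF w', W w)) ^+ 2) = \int[P]_w U w.
  by apply: eq_Rintegral => w _; rewrite G'E F'E.
have varVE : \int[P]_w (\int[P]_w0 (e (PF w, W w0) -
      \int[P]_w1 e (PF w1, (PF w, W w0).2) -
      2 * \int[P]_w1 s (PF w1, (PF w, W w0).2) *
      (s (PF w, W w0) - \int[P]_w1 s (PF w1, (PF w, W w0).2)))) ^+ 2 =
    \int[P]_w (V w - \int[P]_w' V w') ^+ 2.
  apply: eq_Rintegral => w _; rewrite -aE; congr (_ ^+ 2).
  by apply: eq_Rintegral => w' _; rewrite G'E F'E.
have varUE : \int[P]_w (\int[P]_w0 e (PF w0, W w) -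
      (\int[P]_w0 s (PF w0, W w)) ^+ 2 - \int[P]_w U w) ^+ 2 =
    \int[P]_w (U w - \int[P]_w' U w') ^+ 2.
  by apply: eq_Rintegral => w _; rewrite G'E F'E.
by move: clt; rewrite thetaE varVE varUE.
Qed.
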